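(* The rule diagram algebra $(\mathcal D,\mu,\eta,\Delta,\varepsilon,S)$ is a Hopf algebra, with antipode $S$ given by $$S(k\cdot d_\emptyset)=e(k\cdot d_\emptyset)=k\cdot d_\emptyset\quad(k\in\mathbb K),\qquad S(d)=e(d)+\sum_{k=1}^{n}(e-\mathrm{Id})^{\ast k}(d)\quad\text{for } d\in\mathcal D^n\setminus\{d_\emptyset\},\ n>0 .$$
   Context: $\mathbb K$ is a field (such as $\mathbb R$ or $\mathbb C$). Relations. For finite sets $A,B$ a relation is a subset $R\subseteq A\times B$; $S\circ R=\{(a,c)\mid \exists b:(a,b)\in R,(b,c)\in S\}$; for a relation $R$ on one set, $R^*$ is its reflexive transitive closure. $R$ is one-to-one if distinct pairs in $R$ differ in both entries. Graphs and linear rules. A graph is a finite directed multigraph $G=(V_G,E_G,s_G,t_G)$ (loops allowed). A linear rule $r:I\rightharpoonup O$ is an injective partial graph morphism: a pair of one-to-one relations $r\subseteq (V_I\times V_O)\uplus(E_I\times E_O)$ such that for edges $(e,e')\in r$ implies $(s(e),s(e')),(t(e),t(e'))\in r$. It is connected if it is not empty and is not a disjoint union of two non-empty rules. Rule diagrams. A rule diagram $\mathfrak d=(I,O,r,m,s,t)$ consists of graphs $I=\biguplus_{i=1}^n I_i$, $O=\biguplus_{i=1}^n O_i$ (with $s,t$ the source and target maps of $I\uplus O$), $r=\biguplus_i r_i$ with each $r_i:I_i\rightharpoonup O_i$ a connected linear rule, and a one-to-one relation $m=\biguplus_{i<j}m_{i,j}$, where $m_{i,j}\subseteq (V_{O_j}\times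 V_{I_i})\uplus(E_{O_j}\times E_{I_i})$, such that with $\omega_m:=m\circ(r\circ m)^*$: for all edges, $(e,e')\in\omega_m$ implies $(s(e),s(e')),(t(e),t(e'))\in\omega_m$. The numbering of constituents is not part of the data; $\mathfrak d_\emptyset$ is the empty rule diagram ($n=0$). Isomorphisms are pairs of graph isomorphisms $i_I:I\to I'$, $i_O:O\to O'$ with $r'=i_O r i_I^{-1}$, $m'=i_I m i_O^{-1}$. $\mathcal D$ is the $\mathbb K$-vector space with basis the set $\mathfrak D$ of isomorphism classes of rule diagrams; $\delta(\mathfrak d)\in\mathcal D$ is the basis vector of $\mathfrak d$, and $d_\emptyset=\delta(\mathfrak d_\emptyset)$. Algebra structure. $\mu(d_1\otimes d_2)=d_1*_{\mathcal D}d_2$, $\eta(k)=k\cdot d_\emptyset$, where $*_{\mathcal D}$ is bilinear with $\delta(\mathfrak d_A)*_{\mathcal D}\delta(\mathfrak d_B)=\sum_{m_{AB}}\delta\big((I_A\uplus I_B,O_A\uplus O_B,r_A\uplus r_B,m_A\uplus m_{AB}\uplus m_B,s_A\uplus s_B,t_A\uplus t_B)\big)$, the sum being over all one-to-one relations $m_{AB}$ from $O_B$ to $I_A$ (vertices to vertices, edges to edges; $m_{AB}=\emptyset$ allowed) for which the tuple is a rule diagram. Coalgebra structure and filtration. $\mathfrak d_A\uplus\mathfrak d_B$ is the componentwise disjoint union. A non-empty rule diagram is primitive if it is not a disjoint union of two non-empty rule diagrams; every non-empty $\mathfrak d$ is uniquely $\mathfrak d=\mathfrak d(1)\uplus\dots\uplus\mathfrak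 d(n_c)$ with all $\mathfrak d(i)$ primitive ($n_c=0$ for $\mathfrak d_\emptyset$). $\Delta$ is linear with $\Delta(\delta(\mathfrak d))=\sum_{X\subseteq\{1,\dots,n_c\}}\delta(\biguplus_{i\in X}\mathfrak d(i))\otimes\delta(\biguplus_{i\notin X}\mathfrak d(i))$ (empty union $=\mathfrak d_\emptyset$), and $\varepsilon$ is linear with $\varepsilon(d_\emptyset)=1$, $\varepsilon(\delta(\mathfrak d))=0$ for $\mathfrak d\neq\mathfrak d_\emptyset$. $\mathcal D^n$ is the span of the basis diagrams with $n_c\le n$. Convolution powers. $e:=\eta\circ\varepsilon$, and $(e-\mathrm{Id})^{\ast k}:=\mu_k\circ(e-\mathrm{Id})^{\otimes k}\circ\Delta_k$, where $\mu_k:\mathcal D^{\otimes k}\to\mathcal D$ and $\Delta_k:\mathcal D\to\mathcal D^{\otimes k}$ are the $k$-fold iterated product and coproduct ($\mu_1=\Delta_1=\mathrm{Id}$). *)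

(* Defs.v *)
From HB Require Import structures.
From mathcomp Require Import all_boot all_algebra generic_quotient.
From mathcomp Require Import freeg boolp.

Set Implicit Arguments.
Unset Strict Implicit.
Unset Printing Implicit Defensive.

Import GRing.Theory.
Local Open Scope quotient_scope.

Definition one_to_one (A B : finType) (R : {set A * B}) : Prop :=
  forall p q, p \in R -> q \in R -> p != q -> p.1 != q.1 /\ p.2 != q.2.

(* [rel_comp S R] is S o R: first R, then S. *)
Definition rel_comp (A B C : finType) (S : {set B * C}) (R : {set A * B}) :
    {set A * C} :=
  [set p | [exists b, ((p.1, b) \in R) && ((b, p.2) \in S)]].

Definition rel_star (A : finType) (R : {set A * A}) : {set A * A} :=
  [set p | connect [rel x y | (x, y) \in R] p.1 p.2].

Definition omega (I O : finType) (r : {set I * O}) (m : {set O * I}) :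
    {set O * I} :=
  rel_comp m (rel_star (rel_comp r m)).

(* The relation on A1 + A2 and B1 + B2 with diagonal blocks [R1] and [R2] and
   with [X] relating the second summand of the source to the first one of the
   target. *)
Definition rel_block (A1 A2 B1 B2 : finType)
    (R1 : {set A1 * B1}) (X : {set A2 * B1}) (R2 : {set A2 * B2}) :
    {set (A1 + A2) * (B1 + B2)} :=
  [set p | match p with
           | (inl a, inl b) => (a, b) \in R1
           | (inr a, inl b) => (a, b) \in X
           | (inr a, inr b) => (a, b) \in R2
           | (inl _, inr _) => false
           end].

Record graph := Graph {
  vertex : finType;
  edge : finType;
  source : edge -> vertex;
  target : edge -> vertex
}.

Definition graph_empty (G : graph) : bool :=
  (#|vertex G| == 0) && (#|edge G| == 0).

Definition graph_sum (G H : graph) : graph :=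
  @Graph (vertex G + vertex H)%type (edge G + edge H)%type
    (fun e => match e with inl a => inl (source a) | inr b => inr (source b) end)
    (fun e => match e with inl a => inl (target a) | inr b => inr (target b) end).

Definition graph_isom (G H : graph)
    (fV : vertex G -> vertex H) (fE : edge G -> edge H) : Prop :=
  [/\ bijective fV, bijective fE,
      forall e, source (fE e) = fV (source e)
    & forall e, target (fE e) = fV (target e)].

Record rule := Rule {
  input : graph;
  output : graph;
  ruleV : {set vertex input * vertex output};
  ruleE : {set edge input * edge output}
}.
Arguments ruleV : clear implicits.
Arguments ruleE : clear implicits.

Definition linear_rule (r : rule) : Prop :=
  [/\ one_to_one (ruleV r), one_to_one (ruleE r)
    & forall e e', (e, e') \in ruleE r ->
        (source e, source e') \in ruleV r /\ (target e, target e') \in ruleV r].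

Definition rule_empty (r : rule) : bool :=
  graph_empty (input r) && graph_empty (output r).

Definition rule_sum (r1 r2 : rule) : rule :=
  @Rule (graph_sum (input r1) (input r2)) (graph_sum (output r1) (output r2))
    (rel_block (ruleV r1) set0 (ruleV r2))
    (rel_block (ruleE r1) set0 (ruleE r2)).

Definition rule_isom (r r' : rule)
    (iV : vertex (input r) -> vertex (input r'))
    (iE : edge (input r) -> edge (input r'))
    (oV : vertex (output r) -> vertex (output r'))
    (oE : edge (output r) -> edge (output r')) : Prop :=
  [/\ graph_isom iV iE, graph_isom oV oE,
      forall a b, ((iV a, oV b) \in ruleV r') = ((a, b) \in ruleV r)
    & forall a b, ((iE a, oE b) \in ruleE r') = ((a, b) \in ruleE r)].

Definition rule_iso (r r' : rule) : Prop :=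
  exists iV iE oV oE, @rule_isom r r' iV iE oV oE.

Definition connected (r : rule) : Prop :=
  ~~ rule_empty r /\
  ~ exists r1 r2, [/\ linear_rule r1, linear_rule r2,
                      ~~ rule_empty r1, ~~ rule_empty r2
                    & rule_iso r (rule_sum r1 r2)].

(* A presentation of [r] as a disjoint union of n rules.  It is given by the
   index of the summand containing each vertex; an edge lies in the summand of
   its end points. *)
Record splitting (r : rule) (n : nat) := Splitting {
  index_in : vertex (input r) -> 'I_n;
  index_out : vertex (output r) -> 'I_n;
  index_in_edge : forall e, index_in (source e) = index_in (target e);
  index_out_edge : forall e, index_out (source e) = index_out (target e);
  index_rule : forall p, p \in ruleV r -> index_in p.1 = index_out p.2
}.

Section Summand.
Variables (r : rule) (n : nat) (L : splitting r n) (i : 'I_n).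

Lemma summand_in_subproof (e : {e : edge (input r) | index_in L (source e) == i}) :
  index_in L (target (val e)) == i.
Proof. by rewrite -index_in_edge; exact: (valP e). Qed.

Lemma summand_out_subproof (e : {e : edge (output r) | index_out L (source e) == i}) :
  index_out L (target (val e)) == i.
Proof. by rewrite -index_out_edge; exact: (valP e). Qed.

Definition summand_in : graph :=
  @Graph {v : vertex (input r) | index_in L v == i}
         {e : edge (input r) | index_in L (source e) == i}
         (fun e => exist _ (source (val e)) (valP e))
         (fun e => exist _ (target (val e)) (summand_in_subproof e)).

Definition summand_out : graph :=
  @Graph {v : vertex (output r) | index_out L v == i}
         {e : edge (output r) | index_out L (source e) == i}
         (fun e => exist _ (source (val e)) (valP e))
         (fun e => exist _ (target (val e)) (summand_out_subproof e)).

Definition summand : rule :=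
  @Rule summand_in summand_out
    [set p | (val p.1, val p.2) \in ruleV r]
    [set p | (val p.1, val p.2) \in ruleE r].

End Summand.

Record diagram := Diagram {
  drule :> rule;
  matchV : {set vertex (output drule) * vertex (input drule)};
  matchE : {set edge (output drule) * edge (input drule)}
}.
Arguments matchV : clear implicits.
Arguments matchE : clear implicits.

Definition numbering (d : diagram) (n : nat) (L : splitting d n) : Prop :=
  [/\ forall i, connected (summand L i),
      forall p, p \in matchV d -> index_in L p.2 < index_out L p.1
    & forall p, p \in matchE d ->
        index_in L (source p.2) < index_out L (source p.1)].

Definition is_rule_diagram (d : diagram) : Prop :=
  [/\ linear_rule d,
      one_to_one (matchV d) /\ one_to_one (matchE d),
      exists n (L : splitting d n), numbering L
    & forall e e', (e, e') \in omega (ruleE d) (matchE d) ->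
        (source e, source e') \in omega (ruleV d) (matchV d) /\
        (target e, target e') \in omega (ruleV d) (matchV d)].

Definition diagram_isom (d d' : diagram)
    (iV : vertex (input d) -> vertex (input d'))
    (iE : edge (input d) -> edge (input d'))
    (oV : vertex (output d) -> vertex (output d'))
    (oE : edge (output d) -> edge (output d')) : Prop :=
  [/\ @rule_isom d d' iV iE oV oE,
      forall b a, ((oV b, iV a) \in matchV d') = ((b, a) \in matchV d)
    & forall b a, ((oE b, iE a) \in matchE d') = ((b, a) \in matchE d)].

Definition diagram_iso (d d' : diagram) : Prop :=
  exists iV iE oV oE, @diagram_isom d d' iV iE oV oE.

(* Disjoint union of [A] and [B] with match m_A + m_AB + m_B, for m_AB given by
   [XV] on vertices and [XE] on edges; it need not be a rule diagram. *)
Definition compose (A B : diagram)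
    (XV : {set vertex (output B) * vertex (input A)})
    (XE : {set edge (output B) * edge (input A)}) : diagram :=
  @Diagram (rule_sum A B)
    (rel_block (matchV A) XV (matchV B))
    (rel_block (matchE A) XE (matchE B)).

Definition diagram_sum (A B : diagram) : diagram := @compose A B set0 set0.

Definition graph0 : graph := @Graph void void id id.
Definition diagram0 : diagram := @Diagram (@Rule graph0 graph0 set0 set0) set0 set0.

Record rule_diagram := RuleDiagram {
  rd_val :> diagram;
  rd_prop : is_rule_diagram rd_val
}.

Lemma bij_of_inj_surj (A B : finType) (f : A -> B) :
  injective f -> (forall y, exists x, f x = y) -> bijective f.
Proof.
move=> fI fS.
have fS' y : exists x, f x == y by have [x <-] := fS y; exists x.
exists (fun y => xchoose (fS' y)) => [x|y]; last exact: (eqP (xchooseP (fS' y))).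
by apply: fI; exact: (eqP (xchooseP (fS' (f x)))).
Qed.

Lemma connect_inv (T : finType) (e : rel T) (P : T -> Prop) x y :
  P x -> (forall a b, P a -> e a b -> P b) -> connect e x y -> P y.
Proof.
move=> Px Pe /connectP[p + ->]; elim: p x Px => //= a p IHp x Px /andP[exa].
exact/IHp/Pe/exa.
Qed.

Lemma one_to_one_iso (A A' B B' : finType) (f : A -> A') (g : B -> B')
    (R : {set A * B}) (R' : {set A' * B'}) :
  bijective f -> bijective g ->
  (forall a b, ((f a, g b) \in R') = ((a, b) \in R)) ->
  one_to_one R -> one_to_one R'.
Proof.
move=> [f' fK f'K] [g' gK g'K] RR' R1 [a b] [a' b'].
rewrite -(f'K a) -(f'K a') -(g'K b) -(g'K b') !RR' => Rab Rab'.
rewrite xpair_eqE !(can_eq fK) !(can_eq gK) -xpair_eqE => neq.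
exact: R1 Rab Rab' neq.
Qed.

Lemma omega_homo (I I' O O' : finType) (f : O -> O') (g : I -> I')
    (r : {set I * O}) (m : {set O * I}) (r' : {set I' * O'}) (m' : {set O' * I'}) :
  (forall a b, (a, b) \in r -> (g a, f b) \in r') ->
  (forall b a, (b, a) \in m -> (f b, g a) \in m') ->
  forall x y, (x, y) \in omega r m -> (f x, g y) \in omega r' m'.
Proof.
move=> rr' mm' x y; rewrite !inE /= => /existsP[b /andP[]].
rewrite inE /= => xb mby; apply/existsP; exists (f b); rewrite mm' // andbT inE /=.
move: xb; apply: (connect_inv (P := fun c => connect _ (f x) (f c))) => [|c d fc].
  exact: connect0.
rewrite /= inE /= => /existsP[i /andP[ci id]].
apply: connect_trans fc (connect1 _); rewrite /= inE /=.
by apply/existsP; exists (g i); rewrite mm' ?rr'.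
Qed.

Lemma graph_isom_id G : @graph_isom G G id id.
Proof. by split=> //; exists id. Qed.

Lemma graph_isom_comp G1 G2 G3 fV fE gV gE :
  @graph_isom G1 G2 fV fE -> @graph_isom G2 G3 gV gE ->
  graph_isom (gV \o fV) (gE \o fE).
Proof.
move=> [fVb fEb fs ft] [gVb gEb gs gt]; split=> /=; try exact: bij_comp.
- by move=> e; rewrite gs fs.
- by move=> e; rewrite gt ft.
Qed.

Lemma graph_isom_inv G H fV fE gV gE :
  @graph_isom G H fV fE -> cancel gV fV -> cancel gE fE ->
  cancel fV gV -> cancel fE gE -> @graph_isom H G gV gE.
Proof.
move=> [_ _ fs ft] gVK gEK fVK fEK; split.
- by exists fV.
- by exists fE.
- by move=> e; apply: (can_inj fVK); rewrite gVK -fs gEK.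
- by move=> e; apply: (can_inj fVK); rewrite gVK -ft gEK.
Qed.

Lemma diagram_iso_refl d : diagram_iso d d.
Proof.
by exists id, id, id, id; split=> //; split=> //; apply: graph_isom_id.
Qed.

Lemma rule_isom_comp r1 r2 r3 iV iE oV oE iV' iE' oV' oE' :
  @rule_isom r1 r2 iV iE oV oE -> @rule_isom r2 r3 iV' iE' oV' oE' ->
  rule_isom (iV' \o iV) (iE' \o iE) (oV' \o oV) (oE' \o oE).
Proof.
move=> [i o rV rE] [i' o' rV' rE']; split; try exact: graph_isom_comp.
- by move=> a b /=; rewrite rV' rV.
- by move=> a b /=; rewrite rE' rE.
Qed.

Lemma rule_iso_trans r1 r2 r3 : rule_iso r1 r2 -> rule_iso r2 r3 -> rule_iso r1 r3.
Proof.
move=> [iV [iE [oV [oE i]]]] [iV' [iE' [oV' [oE' i']]]].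
by do 4!eexists; apply: rule_isom_comp i i'.
Qed.

Lemma diagram_iso_trans d1 d2 d3 :
  diagram_iso d1 d2 -> diagram_iso d2 d3 -> diagram_iso d1 d3.
Proof.
move=> [iV [iE [oV [oE [i mV mE]]]]] [iV' [iE' [oV' [oE' [i' mV' mE']]]]].
do 4!eexists; split; first exact: rule_isom_comp i i'.
- by move=> b a /=; rewrite mV' mV.
- by move=> b a /=; rewrite mE' mE.
Qed.

Lemma rule_isom_inv r r' iV iE oV oE iV' iE' oV' oE' :
  @rule_isom r r' iV iE oV oE ->
  cancel iV' iV -> cancel iE' iE -> cancel oV' oV -> cancel oE' oE ->
  cancel iV iV' -> cancel iE iE' -> cancel oV oV' -> cancel oE oE' ->
  @rule_isom r' r iV' iE' oV' oE'.
Proof.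
move=> [i o rV rE] iVK iEK oVK oEK ? ? ? ?; split.
- exact: graph_isom_inv i _ _ _ _.
- exact: graph_isom_inv o _ _ _ _.
- by move=> a b; rewrite -rV iVK oVK.
- by move=> a b; rewrite -rE iEK oEK.
Qed.

Lemma rule_iso_sym r r' : rule_iso r r' -> rule_iso r' r.
Proof.
move=> [iV [iE [oV [oE i]]]].
have [[iVb iEb _ _] [oVb oEb _ _] _ _] := i.
case: iVb iEb oVb oEb => [iV' ? ?] [iE' ? ?] [oV' ? ?] [oE' ? ?].
by exists iV', iE', oV', oE'; apply: rule_isom_inv i _ _ _ _ _ _ _ _.
Qed.

Lemma diagram_iso_sym d d' : diagram_iso d d' -> diagram_iso d' d.
Proof.
move=> [iV [iE [oV [oE [i mV mE]]]]].
have [[iVb iEb _ _] [oVb oEb _ _] _ _] := i.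
case: iVb iEb oVb oEb => [iV' ? iVK] [iE' ? iEK] [oV' ? oVK] [oE' ? oEK].
exists iV', iE', oV', oE'; split; first exact: rule_isom_inv i _ _ _ _ _ _ _ _.
- by move=> b a; rewrite -mV oVK iVK.
- by move=> b a; rewrite -mE oEK iEK.
Qed.

Lemma rule_empty_iso r r' : rule_iso r r' -> rule_empty r = rule_empty r'.
Proof.
move=> [iV [iE [oV [oE [[? ? _ _] [? ? _ _] _ _]]]]].
by rewrite /rule_empty /graph_empty (bij_eq_card (f := iV)) //
  (bij_eq_card (f := iE)) // (bij_eq_card (f := oV)) // (bij_eq_card (f := oE)).
Qed.

Lemma connected_iso r r' : rule_iso r r' -> connected r -> connected r'.
Proof.
move=> rr' [rN rC]; split; first by rewrite -(rule_empty_iso rr').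
move=> [r1 [r2 [? ? ? ? r'E]]]; apply: rC; exists r1, r2; split=> //.
exact: rule_iso_trans rr' r'E.
Qed.

Lemma sub_bij (A B : finType) (P : pred A) (Q : pred B) (f : A -> B)
    (PQ : forall x, P x -> Q (f x)) :
  injective f -> (forall y, Q y -> exists2 x, P x & f x = y) ->
  bijective (fun x : {x | P x} => exist Q (f (val x)) (PQ _ (valP x)) : {y | Q y}).
Proof.
move=> fI fS; apply: bij_of_inj_surj => [x y [/fI/val_inj //]|[y Qy]].
have [x Px fx] := fS y Qy; exists (exist _ x Px); exact: val_inj.
Qed.

Lemma summand_iso (r r' : rule) n n' (L : splitting r n) (L' : splitting r' n') i i'
    iV iE oV oE :
  injective iV -> injective iE -> injective oV -> injective oE ->
  (forall e, source (iE e) = iV (source e)) ->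
  (forall e, target (iE e) = iV (target e)) ->
  (forall e, source (oE e) = oV (source e)) ->
  (forall e, target (oE e) = oV (target e)) ->
  (forall a b, ((iV a, oV b) \in ruleV r') = ((a, b) \in ruleV r)) ->
  (forall a b, ((iE a, oE b) \in ruleE r') = ((a, b) \in ruleE r)) ->
  (forall v, (index_in L' (iV v) == i') = (index_in L v == i)) ->
  (forall v, (index_out L' (oV v) == i') = (index_out L v == i)) ->
  (forall v, index_in L' v == i' -> exists u, iV u = v) ->
  (forall v, index_out L' v == i' -> exists u, oV u = v) ->
  (forall e, index_in L' (source e) == i' -> exists u, iE u = e) ->
  (forall e, index_out L' (source e) == i' -> exists u, oE u = e) ->
  rule_iso (summand L i) (summand L' i').
Proof.
move=> iVI iEI oVI oEI iS iT oS oT rV rE Li Lo iVS oVS iES oES.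
have HiV v : index_in L v == i -> index_in L' (iV v) == i' by rewrite Li.
have HoV v : index_out L v == i -> index_out L' (oV v) == i' by rewrite Lo.
have HiE e : index_in L (source e) == i -> index_in L' (source (iE e)) == i'.
  by rewrite iS Li.
have HoE e : index_out L (source e) == i -> index_out L' (source (oE e)) == i'.
  by rewrite oS Lo.
exists (fun x => exist _ (iV (val x)) (HiV _ (valP x))).
exists (fun x => exist _ (iE (val x)) (HiE _ (valP x))).
exists (fun x => exist _ (oV (val x)) (HoV _ (valP x))).
exists (fun x => exist _ (oE (val x)) (HoE _ (valP x))).
split.
- split.
  + apply: (sub_bij (f := iV)) => // y Qy.
    by have [u uy] := iVS _ Qy; exists u => //; rewrite -Li uy.
  + apply: (sub_bij (f := iE)) => // y Qy.
    by have [u uy] := iES _ Qy; exists u => //; rewrite -Li -iS uy.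
  + by move=> e; apply/val_inj; rewrite /= iS.
  + by move=> e; apply/val_inj; rewrite /= iT.
- split.
  + apply: (sub_bij (f := oV)) => // y Qy.
    by have [u uy] := oVS _ Qy; exists u => //; rewrite -Lo uy.
  + apply: (sub_bij (f := oE)) => // y Qy.
    by have [u uy] := oES _ Qy; exists u => //; rewrite -Lo -oS uy.
  + by move=> e; apply/val_inj; rewrite /= oS.
  + by move=> e; apply/val_inj; rewrite /= oT.
- by move=> a b; rewrite !inE /= rV.
- by move=> a b; rewrite !inE /= rE.
Qed.

Lemma is_rule_diagram_iso d d' :
  diagram_iso d d' -> is_rule_diagram d -> is_rule_diagram d'.
Proof.
move=> [iV [iE [oV [oE [i mV mE]]]]] [[rV1 rE1 rVE] [mV1 mE1] [n [L [Lc LV LE]]] dW].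
have [[iVb iEb iS iT] [oVb oEb oS oT] rV rE] := i.
have rV1' := one_to_one_iso iVb oVb rV rV1.
have rE1' := one_to_one_iso iEb oEb rE rE1.
have mV1' := one_to_one_iso oVb iVb mV mV1.
have mE1' := one_to_one_iso oEb iEb mE mE1.
case: iVb iEb oVb oEb => [iV' iVK iVK'] [iE' iEK iEK'] [oV' oVK oVK'] [oE' oEK oEK'].
have iS' e : source (iE' e) = iV' (source e).
  by apply: (can_inj iVK); rewrite iVK' -iS iEK'.
have iT' e : target (iE' e) = iV' (target e).
  by apply: (can_inj iVK); rewrite iVK' -iT iEK'.
have oS' e : source (oE' e) = oV' (source e).
  by apply: (can_inj oVK); rewrite oVK' -oS oEK'.
have oT' e : target (oE' e) = oV' (target e).
  by apply: (can_inj oVK); rewrite oVK' -oT oEK'.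
have rV' a b : ((iV' a, oV' b) \in ruleV d) = ((a, b) \in ruleV d').
  by rewrite -rV iVK' oVK'.
have rE' a b : ((iE' a, oE' b) \in ruleE d) = ((a, b) \in ruleE d').
  by rewrite -rE iEK' oEK'.
have mV' b a : ((oV' b, iV' a) \in matchV d) = ((b, a) \in matchV d').
  by rewrite -mV iVK' oVK'.
have mE' b a : ((oE' b, iE' a) \in matchE d) = ((b, a) \in matchE d').
  by rewrite -mE iEK' oEK'.
split=> //.
- split=> // e e'; rewrite -rE' => /rVE.
  by rewrite iS' iT' oS' oT' !rV'.
- have Li e : index_in L (iV' (source e)) = index_in L (iV' (target e)).
    by rewrite -iS' -iT' index_in_edge.
  have Lo e : index_out L (oV' (source e)) = index_out L (oV' (target e)).
    by rewrite -oS' -oT' index_out_edge.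
  have Lr p : p \in ruleV d' -> index_in L (iV' p.1) = index_out L (oV' p.2).
    by case: p => a b; rewrite -rV' => /(index_rule L).
  exists n, (@Splitting d' n (fun v => index_in L (iV' v))
                          (fun v => index_out L (oV' v)) Li Lo Lr); split.
  + move=> k; apply: connected_iso (Lc k).
    apply: (@summand_iso _ _ _ _ _ _ _ _ iV iE oV oE) => //=; try exact: can_inj.
    * by move=> v; rewrite iVK.
    * by move=> v; rewrite oVK.
    * by move=> v _; exists (iV' v).
    * by move=> v _; exists (oV' v).
    * by move=> v _; exists (iE' v).
    * by move=> v _; exists (oE' v).
  + by move=> [b a] /=; rewrite -mV' => /LV.
  + by move=> [b a] /=; rewrite -mE' => /LE; rewrite iS' oS'.
- have W := omega_homo (f := oV) (g := iV) (r := ruleV d) (m := matchV d)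
    (r' := ruleV d') (m' := matchV d').
  have {}W := W (fun a b => etrans (rV a b)) (fun b a => etrans (mV b a)).
  move=> e e' ee'; have : (oE' e, iE' e') \in omega (ruleE d) (matchE d).
    apply: omega_homo ee' => [a b|b a]; first by rewrite -rE iEK' oEK'.
    by rewrite -mE iEK' oEK'.
  by case/dW => /W + /W; rewrite !(oS', oT', iS', iT') !(oVK', iVK').
Qed.

Lemma diagram0_rule_diagram : is_rule_diagram diagram0.
Proof.
split; [split=> // | split=> // | | by case].
exists 0.
have H0 (v : vertex (input diagram0)) : 'I_0 by case: v.
have H1 (v : vertex (output diagram0)) : 'I_0 by case: v.
have Hi (e : edge (input diagram0)) : H0 (source e) = H0 (target e) by case: e.
have Ho (e : edge (output diagram0)) : H1 (source e) = H1 (target e) by case: e.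
have Hr p : p \in ruleV diagram0 -> H0 p.1 = H1 p.2 by case: p => -[].
exists (@Splitting diagram0 0 H0 H1 Hi Ho Hr).
by split=> [[m] | [[]] | [[]]].
Qed.

Lemma omega_block_l (I I' O O' : finType) (r : {set I * O}) (r' : {set I' * O'})
    (m : {set O * I}) (m' : {set O' * I'}) x y :
  (inl x, y) \in omega (rel_block r set0 r') (rel_block m set0 m') ->
  exists2 y', y = inl y' & (x, y') \in omega r m.
Proof.
rewrite inE /= => /existsP[b /andP[]]; rewrite inE /= => xb.
pose P (b : (O + O')%type) := exists2 b', b = inl b' &
  connect [rel x y | (x, y) \in rel_comp r m] x b'.
have [b' -> xb'] : P b.
  apply: (connect_inv (P := P)) xb => [|_ d [c' -> xc']]; first by exists x.
  rewrite /= inE /= => /existsP[[j|j] /andP[]]; rewrite !inE // => cj.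
  case: d => d //= jd.
  exists d => //; apply: connect_trans xc' (connect1 _).
  by rewrite /= inE /=; apply/existsP; exists j; rewrite cj.
case: y => y; rewrite inE // => b'y; exists y => //.
by rewrite inE /=; apply/existsP; exists b'; rewrite b'y inE /= xb'.
Qed.

Lemma omega_block_r (I I' O O' : finType) (r : {set I * O}) (r' : {set I' * O'})
    (m : {set O * I}) (m' : {set O' * I'}) x y :
  (inr x, y) \in omega (rel_block r set0 r') (rel_block m set0 m') ->
  exists2 y', y = inr y' & (x, y') \in omega r' m'.
Proof.
rewrite inE /= => /existsP[b /andP[]]; rewrite inE /= => xb.
pose P (b : (O + O')%type) := exists2 b', b = inr b' &
  connect [rel x y | (x, y) \in rel_comp r' m'] x b'.
have [b' -> xb'] : P b.
  apply: (connect_inv (P := P)) xb => [|_ d [c' -> xc']]; first by exists x.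
  rewrite /= inE /= => /existsP[[j|j] /andP[]]; rewrite !inE // => cj.
  case: d => d //= jd; first by rewrite inE in jd.
  exists d => //; apply: connect_trans xc' (connect1 _).
  by rewrite /= inE /=; apply/existsP; exists j; rewrite cj.
case: y => y; rewrite !inE // => b'y; exists y => //.
by rewrite inE /=; apply/existsP; exists b'; rewrite b'y inE /= xb'.
Qed.

Lemma one_to_one_block (A1 A2 B1 B2 : finType) (R1 : {set A1 * B1}) (R2 : {set A2 * B2}) :
  one_to_one R1 -> one_to_one R2 -> one_to_one (rel_block R1 set0 R2).
Proof.
move=> R11 R21 [[a|a] [b|b]] [[a'|a'] [b'|b']]; rewrite !inE // => Rab Rab'.
- by move=> neq; apply: (R11 (a, b) (a', b')) Rab Rab' neq.
- by move=> neq; apply: (R21 (a, b) (a', b')) Rab Rab' neq.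
Qed.

Lemma diagram_sum_rule_diagram (A B : diagram) :
  is_rule_diagram A -> is_rule_diagram B -> is_rule_diagram (diagram_sum A B).
Proof.
move=> [[rVA rEA rVEA] [mVA mEA] [n [L [Lc LV LE]]] WA].
move=> [[rVB rEB rVEB] [mVB mEB] [n' [L' [Lc' LV' LE']]] WB].
split.
- split; try exact: one_to_one_block.
  by move=> [e|e] [e'|e']; rewrite !inE //=; [exact: rVEA | exact: rVEB].
- by split; apply: one_to_one_block.
- pose Fi v := match v with inl v => lshift n' (index_in L v)
                          | inr v => rshift n (index_in L' v) end.
  pose Fo v := match v with inl v => lshift n' (index_out L v)
                          | inr v => rshift n (index_out L' v) end.
  have Hi (e : edge (input (diagram_sum A B))) : Fi (source e) = Fi (target e).
    by case: e => e /=; rewrite index_in_edge.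
  have Ho (e : edge (output (diagram_sum A B))) : Fo (source e) = Fo (target e).
    by case: e => e /=; rewrite index_out_edge.
  have Hr p : p \in ruleV (diagram_sum A B) -> Fi p.1 = Fo p.2.
    by case: p => -[a|a] [b|b]; rewrite !inE //= => /index_rule ->.
  have lr k j : (lshift n' k == rshift n j) = false by rewrite eq_lrshift.
  have rl k j : (rshift n j == lshift n' k) = false by rewrite eq_rlshift.
  exists (n + n'), (@Splitting (diagram_sum A B) (n + n') Fi Fo Hi Ho Hr); split.
  + move=> k; case: (split_ordP k) => j ->.
    * apply: connected_iso (Lc j).
      apply: (@summand_iso A (diagram_sum A B) _ _ L _ j _ inl inl inl inl) => //=;
        try (by move=> ? ? []); try (by move=> ? ?; rewrite !inE);
        try (by move=> ?; rewrite /= (inj_eq (@lshift_inj _ _)));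
        by move=> [v|v] /=; rewrite ?rl // => _; exists v.
    * apply: connected_iso (Lc' j).
      apply: (@summand_iso B (diagram_sum A B) _ _ L' _ j _ inr inr inr inr) => //=;
        try (by move=> ? ? []); try (by move=> ? ?; rewrite !inE);
        try (by move=> ?; rewrite /= (inj_eq (@rshift_inj _ _)));
        by move=> [v|v] /=; rewrite ?lr // => _; exists v.
  + move=> [[b|b] [a|a]]; rewrite !inE //=; first exact: LV.
    by rewrite ltn_add2l; exact: LV'.
  + move=> [[b|b] [a|a]]; rewrite !inE //=; first exact: LE.
    by rewrite ltn_add2l; exact: LE'.
- move=> [e|e] e'.
  + case/omega_block_l=> {}e' -> /WA[s t] /=.
    by split; [apply: omega_homo s | apply: omega_homo t] => a b; rewrite !inE.
  + case/omega_block_r=> {}e' -> /WB[s t] /=.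
    by split; [apply: omega_homo s | apply: omega_homo t] => a b; rewrite !inE.
Qed.

Definition sum_map (A B A' B' : Type) (f : A -> A') (g : B -> B') (x : A + B) : A' + B' :=
  match x with inl a => inl (f a) | inr b => inr (g b) end.

Definition sum_swap (A B : Type) (x : A + B) : B + A :=
  match x with inl a => inr a | inr b => inl b end.

Definition sum_assoc (A B C : Type) (x : A + (B + C)) : (A + B) + C :=
  match x with
  | inl a => inl (inl a)
  | inr (inl b) => inl (inr b)
  | inr (inr c) => inr c
  end.

Lemma sum_map_bij (A B A' B' : Type) (f : A -> A') (g : B -> B') :
  bijective f -> bijective g -> bijective (sum_map f g).
Proof.
move=> [f' fK fK'] [g' gK gK']; exists (sum_map f' g').
- by move=> [a|b] /=; rewrite ?fK ?gK.
- by move=> [a|b] /=; rewrite ?fK' ?gK'.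
Qed.

Lemma sum_swap_bij (A B : Type) : bijective (@sum_swap A B).
Proof. by exists (@sum_swap B A); case. Qed.

Lemma sum_assoc_bij (A B C : Type) : bijective (@sum_assoc A B C).
Proof.
exists (fun x => match x with
  | inl (inl a) => inl a | inl (inr b) => inr (inl b) | inr c => inr (inr c) end).
- by move=> [a|[b|c]].
- by move=> [[a|b]|c].
Qed.

Lemma diagram_sum_congr A A' B B' :
  diagram_iso A A' -> diagram_iso B B' ->
  diagram_iso (diagram_sum A B) (diagram_sum A' B').
Proof.
move=> [iV [iE [oV [oE [[[? ? iS iT] [? ? oS oT] rV rE] mV mE]]]]].
move=> [iV' [iE' [oV' [oE' [[[? ? iS' iT'] [? ? oS' oT'] rV' rE'] mV' mE']]]]].
exists (sum_map iV iV'), (sum_map iE iE'), (sum_map oV oV'), (sum_map oE oE').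
split; [split; [split | split | | ] | |]; try exact: sum_map_bij.
- by move=> [e|e] /=; rewrite ?iS ?iS'.
- by move=> [e|e] /=; rewrite ?iT ?iT'.
- by move=> [e|e] /=; rewrite ?oS ?oS'.
- by move=> [e|e] /=; rewrite ?oT ?oT'.
- by move=> [a|a] [b|b]; rewrite !inE /= ?inE ?(rV, rV', rE, rE', mV, mV', mE, mE').
- by move=> [a|a] [b|b]; rewrite !inE /= ?inE ?(rV, rV', rE, rE', mV, mV', mE, mE').
- by move=> [a|a] [b|b]; rewrite !inE /= ?inE ?(rV, rV', rE, rE', mV, mV', mE, mE').
- by move=> [a|a] [b|b]; rewrite !inE /= ?inE ?(rV, rV', rE, rE', mV, mV', mE, mE').
Qed.

Lemma diagram_sumC A B : diagram_iso (diagram_sum A B) (diagram_sum B A).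
Proof.
exists (@sum_swap _ _), (@sum_swap _ _), (@sum_swap _ _), (@sum_swap _ _).
split; [split; [split | split | | ] | |]; try exact: sum_swap_bij;
  try (by case); by move=> [a|a] [b|b]; rewrite !inE /= ?inE.
Qed.

Lemma diagram_sumA A B C :
  diagram_iso (diagram_sum A (diagram_sum B C)) (diagram_sum (diagram_sum A B) C).
Proof.
exists (@sum_assoc _ _ _), (@sum_assoc _ _ _), (@sum_assoc _ _ _), (@sum_assoc _ _ _).
split; [split; [split | split | | ] | |]; try exact: sum_assoc_bij;
  try (by move=> [|[]]); by move=> [a|[a|a]] [b|[b|b]]; rewrite !inE /= ?inE.
Qed.

Lemma diagram_sum0 A : diagram_iso A (diagram_sum diagram0 A).
Proof.
have inr_bij (T : finType) : bijective (@inr void T).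
  apply: bij_of_inj_surj; first by move=> x y [].
  by case=> [[]|y]; exists y.
exists inr, inr, inr, inr.
split; [split; [split | split | | ] | |]; try exact: inr_bij; try done;
  by move=> a b; rewrite !inE.
Qed.

Lemma diagram_iso0 (A : diagram) : rule_empty A -> diagram_iso diagram0 A.
Proof.
move=> /andP[/andP[/eqP/card0_eq iV /eqP/card0_eq iE] /andP[/eqP/card0_eq oV /eqP/card0_eq oE]].
have void_bij (T : finType) : T =i pred0 -> bijective (of_void T).
  by move=> T0; apply: bij_of_inj_surj => [[] | x]; have := T0 x.
exists (of_void _), (of_void _), (of_void _), (of_void _).
by split; [split; [split | split | | ] | |]; try exact: void_bij; case.
Qed.

(* Rule diagrams carried by the finite sets {0, ..., n-1}: a small type of
   representatives of all isomorphism classes ([diagram] is too large a type to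
   be the set of generators of a free vector space). *)
Record code := Code {
  code_iV : nat; code_iE : nat; code_oV : nat; code_oE : nat;
  code_isource : 'I_code_iE -> 'I_code_iV;
  code_itarget : 'I_code_iE -> 'I_code_iV;
  code_osource : 'I_code_oE -> 'I_code_oV;
  code_otarget : 'I_code_oE -> 'I_code_oV;
  code_ruleV : {set 'I_code_iV * 'I_code_oV};
  code_ruleE : {set 'I_code_iE * 'I_code_oE};
  code_matchV : {set 'I_code_oV * 'I_code_iV};
  code_matchE : {set 'I_code_oE * 'I_code_iE}
}.

HB.instance Definition _ := gen_eqMixin code.
HB.instance Definition _ := gen_choiceMixin code.

Definition decode (c : code) : diagram :=
  @Diagram
    (@Rule (Graph (@code_isource c) (@code_itarget c))
           (Graph (@code_osource c) (@code_otarget c))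
           (code_ruleV c) (code_ruleE c))
    (code_matchV c) (code_matchE c).

Definition encode (d : diagram) : code :=
  @Code #|vertex (input d)| #|edge (input d)| #|vertex (output d)| #|edge (output d)|
    (fun e => enum_rank (source (enum_val e)))
    (fun e => enum_rank (target (enum_val e)))
    (fun e => enum_rank (source (enum_val e)))
    (fun e => enum_rank (target (enum_val e)))
    [set p | (enum_val p.1, enum_val p.2) \in ruleV d]
    [set p | (enum_val p.1, enum_val p.2) \in ruleE d]
    [set p | (enum_val p.1, enum_val p.2) \in matchV d]
    [set p | (enum_val p.1, enum_val p.2) \in matchE d].

Lemma encode_iso d : diagram_iso d (decode (encode d)).
Proof.
exists enum_rank, enum_rank, enum_rank, enum_rank.
split; [split; [split | split | | ] | |]; try exact: enum_rank_bij;
  try (by move=> e /=; rewrite enum_rankK);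
  by move=> a b /=; rewrite inE /= !enum_rankK.
Qed.

Definition diagram_code := {c : code | `[< is_rule_diagram (decode c) >]}.
HB.instance Definition _ := Choice.on diagram_code.

Definition code_iso (c c' : diagram_code) : bool :=
  `[< diagram_iso (decode (val c)) (decode (val c')) >].

Lemma code_iso_equiv : equiv_class_of code_iso.
Proof.
split=> [c | c c' | c c' c''].
- exact/asboolP/diagram_iso_refl.
- by apply/asboolP/asboolP; apply: diagram_iso_sym.
- by move=> /asboolP cc' /asboolP c'c; apply/asboolP; apply: diagram_iso_trans cc' c'c.
Qed.

Canonical code_iso_equiv_rel := EquivRelPack code_iso_equiv.

Definition dclass := {eq_quot code_iso}.
HB.instance Definition _ := Choice.on dclass.
HB.instance Definition _ := EqQuotient.on dclass.

Lemma encode_subproof (d : rule_diagram) :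
  `[< is_rule_diagram (decode (encode d)) >].
Proof. exact/asboolP/(is_rule_diagram_iso (encode_iso d))/rd_prop. Qed.

Definition class_of (d : rule_diagram) : dclass :=
  \pi_dclass (exist _ (encode d) (encode_subproof d) : diagram_code).

Definition rep (x : dclass) : rule_diagram :=
  RuleDiagram (asboolW (valP (repr x : diagram_code))).

Lemma class_ofP (d d' : rule_diagram) : class_of d = class_of d' <-> diagram_iso d d'.
Proof.
split=> [/eqP | dd'].
- rewrite eqmodE => /asboolP /= ee'; apply: diagram_iso_trans (encode_iso d) _.
  exact: diagram_iso_trans ee' (diagram_iso_sym (encode_iso d')).
- apply/eqP; rewrite eqmodE; apply/asboolP => /=.
  apply: diagram_iso_trans (encode_iso d').
  exact: diagram_iso_trans (diagram_iso_sym (encode_iso d)) dd'.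
Qed.

Lemma repK (x : dclass) : class_of (rep x) = x.
Proof.
rewrite -[RHS]reprK; apply/eqP; rewrite eqmodE; apply/asboolP => /=.
exact/diagram_iso_sym/encode_iso.
Qed.

Lemma rep_class_of (d : rule_diagram) : diagram_iso (rep (class_of d)) d.
Proof. by apply/class_ofP; rewrite repK. Qed.

Definition class0 : dclass := class_of (RuleDiagram diagram0_rule_diagram).

Definition class_sum (x y : dclass) : dclass :=
  class_of (RuleDiagram (diagram_sum_rule_diagram (rd_prop (rep x)) (rd_prop (rep y)))).

Lemma class_sumC : commutative class_sum.
Proof. by move=> x y; apply/class_ofP/diagram_sumC. Qed.

Lemma class_sumA : associative class_sum.
Proof.
move=> x y z; apply/class_ofP => /=.
apply: diagram_iso_trans (diagram_sum_congr (diagram_iso_refl _) (rep_class_of _)) _ => /=.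
apply: diagram_iso_trans (diagram_sumA _ _ _) _.
apply: diagram_sum_congr (diagram_iso_refl _).
exact/diagram_iso_sym/rep_class_of.
Qed.

Lemma class_sum0 : left_id class0 class_sum.
Proof.
move=> x; rewrite -[RHS]repK; apply/class_ofP => /=.
apply: diagram_iso_trans (diagram_sum_congr (rep_class_of _) (diagram_iso_refl _)) _.
exact/diagram_iso_sym/diagram_sum0.
Qed.

HB.instance Definition _ := Monoid.isComLaw.Build dclass class0 class_sum
  class_sumA class_sumC class_sum0.

Definition primitive (x : dclass) : Prop :=
  x <> class0 /\ ~ exists y z, [/\ y <> class0, z <> class0 & x = class_sum y z].

Definition is_decomposition (x : dclass) (s : seq dclass) : Prop :=
  (forall y, y \in s -> primitive y) /\ x = \big[class_sum/class0]_(y <- s) y.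

Definition order_of (d : diagram) : nat := #|vertex (input d)| + #|vertex (output d)|.

Lemma order_of_iso d d' : diagram_iso d d' -> order_of d = order_of d'.
Proof.
move=> [iV [iE [oV [oE [[[iVb _ _ _] [oVb _ _ _] _ _] _ _]]]]].
by rewrite /order_of (bij_eq_card iVb) (bij_eq_card oVb).
Qed.

Lemma order_of_class_sum x y :
  order_of (rep (class_sum x y)) = order_of (rep x) + order_of (rep y).
Proof.
by rewrite (order_of_iso (rep_class_of _)) /order_of /= !card_sum addnACA.
Qed.

Lemma order_of_gt0 x : x <> class0 -> 0 < order_of (rep x).
Proof.
move=> x0; rewrite lt0n; apply/negP => /eqP/eqP; rewrite addn_eq0 => /andP[i0 o0].
have empty (G : graph) : #|vertex G| == 0 -> graph_empty G.
  move=> G0; rewrite /graph_empty G0 /=; apply/eqP/eq_card0 => e.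
  by move/eqP/card0_eq/(_ (source e)): G0.
apply: x0; rewrite -[LHS]repK; apply/class_ofP/diagram_iso_sym/diagram_iso0.
by rewrite /rule_empty !empty.
Qed.

Lemma decomposition_exists x : exists s, is_decomposition x s.
Proof.
have [n] := ubnP (order_of (rep x)); elim: n x => // n IHn x le_xn.
have [->|x0] := EM (x = class0); first by exists [::]; split=> //; rewrite big_nil.
have [px|px] := EM (primitive x).
  by exists [:: x]; split=> [y|]; rewrite ?big_seq1 // inE => /eqP ->.
have [y [z [y0 z0 xE]]] :
    exists y z, [/\ y <> class0, z <> class0 & x = class_sum y z].
  by apply: contrapT => nx; apply: px.
have le_yz : (order_of (rep y) < n) && (order_of (rep z) < n).
  move: le_xn; rewrite xE order_of_class_sum ltnS => le_yzn.
  have yp := order_of_gt0 y0; have zp := order_of_gt0 z0.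
  apply/andP; split; apply: leq_trans le_yzn; first by rewrite -addn1 leq_add2l.
  by rewrite -add1n leq_add2r.
have [/IHn[s [sp sE]] /IHn[t [tp tE]]] := andP le_yz.
exists (s ++ t); split=> [w|]; last by rewrite big_cat /= -sE -tE.
by rewrite mem_cat => /orP[/sp|/tp].
Qed.

(* A choice of decomposition; decompositions only differ by the order of their
   terms. *)
Definition components (x : dclass) : seq dclass := projT1 (cid (decomposition_exists x)).

Definition num_components (x : dclass) : nat := size (components x).

Local Open Scope ring_scope.

Section Free.
Variable K : fieldType.

Local Notation F X := {freeg X%type / K}.

Section LinearExtension.
Variables (X : choiceType) (M : lmodType K) (f : X -> M).

Definition linext (d : {freeg X / K}) : M := fglift f d.

Lemma linext_is_additive : zmod_morphism linext.
Proof. exact: lift_is_additive. Qed.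

HB.instance Definition _ :=
  GRing.isZmodMorphism.Build {freeg X / K} M linext linext_is_additive.

Lemma linextE d : linext d = \sum_(x <- dom d) coeff x d *: f x.
Proof.
rewrite -{1}(freeg_sumE d) raddf_sum; apply: eq_bigr => x _.
by rewrite /= /linext liftU.
Qed.

Lemma linext_is_scalable : scalable linext.
Proof.
move=> c d; rewrite -(freeg_sumE d) scaler_sumr !raddf_sum /=.
apply: eq_bigr => x _.
have -> : c *: << coeff x d *g x >> = << c * coeff x d *g x >> :> {freeg X / K}.
  by apply/eqP/freeg_eqP => y; rewrite coeffZ !coeffU mulrA.
by rewrite /linext !liftU scalerA.
Qed.

HB.instance Definition _ :=
  GRing.isScalable.Build K {freeg X / K} M *:%R linext linext_is_scalable.

Lemma linextU x : linext << x >> = f x.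
Proof. by rewrite /linext liftU scale1r. Qed.

End LinearExtension.

Lemma linear_freeg_eq (X : choiceType) (M : lmodType K) (f g : {linear {freeg X / K} -> M}) :
  (forall x, f << x >> = g << x >>) -> f =1 g.
Proof.
move=> fg d; rewrite -(freeg_sumE d) !raddf_sum; apply: eq_bigr => x _.
have -> : << coeff x d *g x >> = coeff x d *: << x >> :> {freeg X / K}.
  by apply/eqP/freeg_eqP => y; rewrite coeffZ !coeffU mul1r.
by rewrite /= !linearZ /= fg.
Qed.

Lemma eq_on_basis (X : choiceType) (M : lmodType K) (f g : F X -> M) :
  linear f -> linear g -> (forall x, f << x >> = g << x >>) -> f =1 g.
Proof.
move=> fl gl; pose f' : {linear F X -> M} := HB.pack f (GRing.isLinear.Build K _ M *:%R f fl).
pose g' : {linear F X -> M} := HB.pack g (GRing.isLinear.Build K _ M *:%R g gl).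
exact: (@linear_freeg_eq X M f' g').
Qed.

(* The tensor product of the free vector spaces on X and Y is the free vector
   space on X * Y. *)
Definition tens (X Y : choiceType) (u : F X) (v : F Y) :
    F (X * Y) :=
  linext (fun x => linext (fun y => << (x, y) >>) v) u.

Lemma tensU (X Y : choiceType) (x : X) (y : Y) : tens << x >> << y >> = << (x, y) >>.
Proof. by rewrite /tens !linextU. Qed.

Lemma tens_linear_l (X Y : choiceType) (v : F Y) :
  linear (fun u : F X => tens u v).
Proof. by move=> c u u'; rewrite /tens linearP. Qed.

Lemma tens_linear_r (X Y : choiceType) (u : F X) :
  linear (tens u : F Y -> F (X * Y)).
Proof.
move=> c v v'; rewrite /tens !linextE scaler_sumr -big_split /=.
by apply: eq_bigr => x _; rewrite linearP scalerDr !scalerA mulrC.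
Qed.

Lemma tens_universal (X Y : choiceType) (M : lmodType K)
    (b : F X -> F Y -> M) :
  (forall v, linear (b^~ v)) -> (forall u, linear (b u)) ->
  exists f : {linear F (X * Y) -> M},
    (forall u v, f (tens u v) = b u v) /\
    forall g : {linear F (X * Y) -> M},
      (forall u v, g (tens u v) = b u v) -> g =1 f.
Proof.
move=> bl br; pose f : {linear F (X * Y) -> M} :=
  linext (fun p : X * Y => b << p.1 >> << p.2 >>).
exists f; split=> [u v | g gE]; last first.
  by apply: linear_freeg_eq => -[x y]; rewrite -tensU gE /f /= tensU linextU.
apply: (eq_on_basis (f := fun u => f (tens u v)) (g := b^~ v)) => //.
  by move=> c u1 u2; rewrite tens_linear_l linearP.
move=> x; apply: (eq_on_basis (f := fun v => f (tens << x >> v)) (g := b << x >>)) => //.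
  by move=> c v1 v2; rewrite tens_linear_r linearP.
by move=> y; rewrite tensU /f /= linextU.
Qed.

Definition tens_map (X Y X' Y' : choiceType)
    (f : {linear F X -> F (X')})
    (g : {linear F Y -> F (Y')}) :
    {linear F (X * Y) -> F (X' * Y')} :=
  linext (fun p : X * Y => tens (f << p.1 >>) (g << p.2 >>)).

(* phi (x) id and id (x) phi, composed with the identifications of K (x) V and
   V (x) K with V. *)
Definition contract_l (X Y : choiceType) (phi : {linear F X -> K^o}) :
    {linear F (X * Y) -> F Y} :=
  linext (fun p : X * Y => (phi << p.1 >> : K) *: << p.2 >>).

Definition contract_r (X Y : choiceType) (phi : {linear F Y -> K^o}) :
    {linear F (X * Y) -> F X} :=
  linext (fun p : X * Y => (phi << p.2 >> : K) *: << p.1 >>).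

Definition tens_assoc (X Y Z : choiceType) :
    {linear F ((X * Y) * Z) -> F (X * (Y * Z))} :=
  linext (fun p : (X * Y) * Z => << (p.1.1, (p.1.2, p.2)) >>).

(* id (x) tau (x) id, for tau the flip of the two middle factors. *)
Definition tens_swap (X Y Z T : choiceType) :
    {linear F ((X * Y) * (Z * T)) -> F ((X * Z) * (Y * T))} :=
  linext (fun p : (X * Y) * (Z * T) => << ((p.1.1, p.2.1), (p.1.2, p.2.2)) >>).

Section Hopf.
Variable X : choiceType.
Local Notation H := (F X).
Local Notation H2 := (F (X * X)).
Variables (mu : {linear H2 -> H}) (eta : {linear K^o -> H}).
Variables (Delta : {linear H -> H2}) (eps : {linear H -> K^o}).

Definition is_algebra : Prop :=
  [/\ forall w : F ((X * X) * X),
        mu (tens_map mu idfun w) = mu (tens_map idfun mu (tens_assoc X X X w)),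
      forall (k : K) d, mu (tens (eta k) d) = k *: d
    & forall (k : K) d, mu (tens d (eta k)) = k *: d].

Definition is_coalgebra : Prop :=
  [/\ forall d, tens_assoc X X X (tens_map Delta idfun (Delta d)) =
                tens_map idfun Delta (Delta d),
      forall d, contract_l X eps (Delta d) = d
    & forall d, contract_r X eps (Delta d) = d].

Definition is_bialgebra : Prop :=
  [/\ is_algebra, is_coalgebra,
      (forall w, Delta (mu w) =
         tens_map mu mu (tens_swap X X X X (tens_map Delta Delta w))) /\
      (forall k : K, Delta (eta k) = k *: tens (eta 1) (eta 1))
    & (forall d d', eps (mu (tens d d')) = (eps d : K) * (eps d' : K)) /\
      (forall k : K, eps (eta k) = k)].

Definition is_antipode (S : {linear H -> H}) : Prop :=
  (forall d, mu (tens_map S idfun (Delta d)) = eta (eps d)) /\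
  (forall d, mu (tens_map idfun S (Delta d)) = eta (eps d)).

Definition is_hopf_algebra (S : {linear H -> H}) : Prop :=
  is_bialgebra /\ is_antipode S.

(* [tpow k] is a basis of the tensor power of H with k + 1 factors, bracketed
   to the right. *)
Fixpoint tpow (k : nat) : choiceType :=
  if k is k'.+1 then (X * tpow k')%type else X.

Fixpoint tpow_map (f : {linear H -> H}) (k : nat) :
    {linear F (tpow k) -> F (tpow k)} :=
  if k is k'.+1 then tens_map f (tpow_map f k') else f.

Fixpoint iter_mul (k : nat) : {linear F (tpow k) -> H} :=
  if k is k'.+1 then mu \o tens_map idfun (iter_mul k') else idfun.

Fixpoint iter_comul (k : nat) : {linear H -> F (tpow k)} :=
  if k is k'.+1 then tens_map idfun (iter_comul k') \o Delta else idfun.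

(* The convolution power f^{*k}, meaningful for k > 0. *)
Definition convpow (f : {linear H -> H}) (k : nat) : {linear H -> H} :=
  iter_mul k.-1 \o tpow_map f k.-1 \o iter_comul k.-1.

End Hopf.

Definition delta (d : rule_diagram) : F dclass := << class_of d >>.

Definition d_empty : F dclass := << class0 >>.

Definition is_match (A B : diagram)
    (m : {set vertex (output B) * vertex (input A)} *
         {set edge (output B) * edge (input A)}) : bool :=
  `[< is_rule_diagram (@compose A B m.1 m.2) >].

Definition rd_compose (A B : diagram) (m : {m | @is_match A B m}) : rule_diagram :=
  RuleDiagram (asboolW (valP m)).

Definition rd_mu : {linear F (dclass * dclass) -> F dclass} :=
  linext (fun p : dclass * dclass =>
    \sum_(m : {m | @is_match (rep p.1) (rep p.2) m}) delta (rd_compose m)).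

Definition rd_eta_fun (k : K^o) : F dclass := (k : K) *: d_empty.

Lemma rd_eta_is_linear : linear rd_eta_fun.
Proof. by move=> c k k'; rewrite /rd_eta_fun scalerDl -scalerA. Qed.

HB.instance Definition _ :=
  GRing.isLinear.Build K K^o (F dclass) *:%R rd_eta_fun rd_eta_is_linear.

Definition rd_eta : {linear K^o -> F dclass} := rd_eta_fun.

Definition union_of (x : dclass) (J : {set 'I_(num_components x)}) : dclass :=
  \big[class_sum/class0]_(i in J) nth class0 (components x) i.

Definition rd_Delta : {linear F dclass -> F (dclass * dclass)} :=
  linext (fun x : dclass =>
    \sum_(J : {set 'I_(num_components x)})
       tens << union_of J >> << union_of (~: J) >>).

Definition rd_eps : {linear F dclass -> K^o} :=
  linext (fun x : dclass => (x == class0)%:R : K^o).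

Definition rd_e : {linear F dclass -> F dclass} := rd_eta \o rd_eps.

Definition rd_convpow (k : nat) : {linear F dclass -> F dclass} :=
  convpow rd_mu rd_Delta (rd_e \- idfun) k.

Definition in_filtration (n : nat) (d : F dclass) : Prop :=
  exists s : seq (K * dclass),
    (forall p, p \in s -> (num_components p.2 <= n)%N) /\
    d = \sum_(p <- s) p.1 *: << p.2 >>.

End Free.

Arguments d_empty : clear implicits.
Arguments rd_mu : clear implicits.
Arguments rd_eta : clear implicits.
Arguments rd_Delta : clear implicits.
Arguments rd_eps : clear implicits.
Arguments rd_e : clear implicits.
Arguments rd_convpow : clear implicits.

(* Main.v *)
Require Import Defs.
From HB Require Import structures.
From mathcomp Require Import all_boot all_algebra.
From mathcomp Require Import freeg boolp.

(** Idea. A product of the basis vectors of A and B is the sum, over all pairs of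
    relations m from O_B to I_A, of the composites A *_m B, with composites that
    are not rule diagrams counted as 0; associativity holds because the
    compatibility condition on omega passes to the blocks A *_m B and B *_m C of
    a triple composite, no path of matches and rules leaving and re-entering a
    block.

    The coproduct of d is the sum of d_1 (x) d_2 over all two-colourings of the
    vertices of d, where a colouring contributes only if it comes from an
    isomorphism of d with a disjoint union d_1 + d_2 of rule diagrams; for a
    primitive d these are the two constant colourings, which gives
    Delta(y + x) = (y (x) 1 + 1 (x) y) Delta(x), and with it coassociativity and
    the counit.  In this form Delta is multiplicative: a match m and a colouring
    of A *_m B amount to colourings of A and B together with a match between the
    parts of each colour.

    Finally e - Id kills the empty diagram, so its k-th convolution power
    vanishes on diagrams with fewer than k components, and the geometric series
    of e - Id is a two-sided convolution inverse of Id = e - (e - Id). *)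

Set Implicit Arguments.
Unset Strict Implicit.
Unset Printing Implicit Defensive.

Import GRing.Theory.

(** * Sub-diagrams of composites *)

Section Blocks.
Variables (I I' O O' : finType).
Variables (r : {set I * O}) (r' : {set I' * O'}).
Variables (m : {set O * I}) (X : {set O' * I}) (m' : {set O' * I'}).

(** The only off-diagonal block leads from the second summand to the first, so a path of matches and
    rules that starts in the first summand stays there. *)
Lemma omega_block_ll x y :
  (inl x, inl y) \in omega (rel_block r set0 r') (rel_block m X m') ->
  (x, y) \in omega r m.
Proof.
rewrite inE /= => /existsP[b /andP[]]; rewrite inE /= => xb.
pose P (b : (O + O')%type) := exists2 b', b = inl b' &
  connect [rel x y | (x, y) \in rel_comp r m] x b'.
have [b' -> xb'] : P b.
  apply: (connect_inv (P := P)) xb => [|_ d [c' -> xc']]; first by exists x.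
  rewrite /= inE /= => /existsP[[j|j] /andP[]]; rewrite !inE // => cj.
  case: d => d //= jd.
  exists d => //; apply: connect_trans xc' (connect1 _).
  by rewrite /= inE /=; apply/existsP; exists j; rewrite cj.
rewrite inE => b'y; rewrite inE /=; apply/existsP; exists b'.
by rewrite b'y inE /= xb'.
Qed.

Lemma omega_block_rr x y :
  (inr x, inr y) \in omega (rel_block r set0 r') (rel_block m X m') ->
  (x, y) \in omega r' m'.
Proof.
rewrite inE /= => /existsP[b /andP[]]; rewrite inE /= => xb.
(* The invariant is vacuous on the first summand: a path that has entered it cannot come back, and
   the present one ends at [inr y]. *)
pose P (b : (O + O')%type) := if b is inr b' then
  connect [rel x y | (x, y) \in rel_comp r' m'] x b' : Prop else True.
have : P b.
  apply: (connect_inv (P := P)) xb => [|c d Pc]; first exact: connect0.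
  rewrite /= inE /= => /existsP[j /andP[]]; rewrite !inE.
  case: c d j Pc => [c|c] [d|d] [j|j] //=; rewrite ?inE // => xc cj jd.
  apply: connect_trans xc (connect1 _).
  by rewrite /= inE /=; apply/existsP; exists j; rewrite cj.
case: b {xb} => b /=; rewrite !inE // => xb b_y.
by apply/existsP; exists b; rewrite b_y inE /= xb.
Qed.

End Blocks.

Lemma one_to_one_block_inv (A1 A2 B1 B2 : finType) (R1 : {set A1 * B1})
    (X : {set A2 * B1}) (R2 : {set A2 * B2}) :
  one_to_one (rel_block R1 X R2) -> one_to_one R1 /\ one_to_one R2.
Proof.
move=> R; split=> -[a b] [a' b'] ab ab' neq.
- by apply: (R (inl a, inl b) (inl a', inl b')); rewrite ?inE.
- by apply: (R (inr a, inr b) (inr a', inr b')); rewrite ?inE.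
Qed.

(** The part of [is_rule_diagram] that a composite of two rule diagrams can fail; it passes from a
    composite to both of its blocks. *)
Definition coherent (d : diagram) : Prop :=
  [/\ one_to_one (matchV d), one_to_one (matchE d)
    & forall e e', (e, e') \in omega (ruleE d) (matchE d) ->
        (source e, source e') \in omega (ruleV d) (matchV d) /\
        (target e, target e') \in omega (ruleV d) (matchV d)].

Lemma rule_diagram_coherent d : is_rule_diagram d -> coherent d.
Proof. by case=> _ [] *; split. Qed.

Section Compose.
Variables (A B : diagram).
Variables (XV : {set vertex (output B) * vertex (input A)}).
Variables (XE : {set edge (output B) * edge (input A)}).

(** An [omega] path of edges of A is also one in the composite; the vertex paths obtained there have
    both ends in A, so they come back by [omega_block_ll]. *)
Lemma coherent_compose_l : coherent (compose XV XE) -> coherent A.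
Proof.
move=> [/one_to_one_block_inv[? _] /one_to_one_block_inv[? _] W]; split=> // e e' ee'.
have /W[] : (inl e, inl e') \in omega (ruleE (compose XV XE)) (matchE (compose XV XE)).
  by apply: omega_homo ee' => *; rewrite inE.
by split; [apply: omega_block_ll a | apply: omega_block_ll b].
Qed.

Lemma coherent_compose_r : coherent (compose XV XE) -> coherent B.
Proof.
move=> [/one_to_one_block_inv[_ ?] /one_to_one_block_inv[_ ?] W]; split=> // e e' ee'.
have /W[] : (inr e, inr e') \in omega (ruleE (compose XV XE)) (matchE (compose XV XE)).
  by apply: omega_homo ee' => *; rewrite inE.
by split; [apply: omega_block_rr a | apply: omega_block_rr b].
Qed.

(** Numbering the constituents of A before those of B makes every match from B to A go down, so only
    coherence has to be assumed. *)
Lemma compose_rule_diagram :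
  is_rule_diagram A -> is_rule_diagram B -> coherent (compose XV XE) ->
  is_rule_diagram (compose XV XE).
Proof.
move=> [[rVA rEA rVEA] _ [n [L [Lc LV LE]]] _].
move=> [[rVB rEB rVEB] _ [n' [L' [Lc' LV' LE']]] _] [mV mE W].
split=> //.
  split; try exact: one_to_one_block.
  by move=> [e|e] [e'|e']; rewrite !inE //=; [exact: rVEA | exact: rVEB].
pose Fi v := match v with inl v => lshift n' (index_in L v)
                        | inr v => rshift n (index_in L' v) end.
pose Fo v := match v with inl v => lshift n' (index_out L v)
                        | inr v => rshift n (index_out L' v) end.
have Hi (e : edge (input (rule_sum A B))) : Fi (source e) = Fi (target e).
  by case: e => e /=; rewrite index_in_edge.
have Ho (e : edge (output (rule_sum A B))) : Fo (source e) = Fo (target e).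
  by case: e => e /=; rewrite index_out_edge.
have Hr p : p \in ruleV (rule_sum A B) -> Fi p.1 = Fo p.2.
  by case: p => -[a|a] [b|b]; rewrite !inE //= => /index_rule ->.
exists (n + n'), (Splitting Hi Ho Hr); split.
- move=> k; case: (split_ordP k) => j ->.
  + apply: connected_iso (Lc j).
    apply: (@summand_iso A (rule_sum A B) _ _ L _ j _ inl inl inl inl) => //=;
      try (by move=> ? ? []); try (by move=> ? ?; rewrite inE);
      try (by move=> ?; rewrite /= (inj_eq (@lshift_inj _ _)));
      by move=> [v|v] /=; rewrite ?eq_rlshift // => _; exists v.
  + apply: connected_iso (Lc' j).
    apply: (@summand_iso B (rule_sum A B) _ _ L' _ j _ inr inr inr inr) => //=;
      try (by move=> ? ? []); try (by move=> ? ?; rewrite inE);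
      try (by move=> ?; rewrite /= (inj_eq (@rshift_inj _ _)));
      by move=> [v|v] /=; rewrite ?eq_lrshift // => _; exists v.
- move=> [[b|b] [a|a]]; rewrite inE //=; first exact: LV.
    by move=> _; rewrite ltn_addr.
  by move=> /LV'; rewrite /= ltn_add2l.
- move=> [[b|b] [a|a]]; rewrite inE //=; first exact: LE.
    by move=> _; rewrite ltn_addr.
  by move=> /LE'; rewrite /= ltn_add2l.
Qed.

End Compose.

(** * Summands of a disjoint union are rule diagrams *)

Section Rank.
Variables (n : nat) (S : {set 'I_n}).

(** On [S] this is the order isomorphism onto the initial segment of length [#|S|]; it closes the
    gaps left by dropped indices. *)
Definition rank (i : 'I_n) : nat := #|[set j : 'I_n | (j \in S) && (j < i)]|.

Lemma rank_lt i : i \in S -> rank i < #|S|.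
Proof.
move=> iS; apply/proper_card/properP; split; first by apply/subsetP=> j /setIdP[].
by exists i; rewrite // inE ltnn andbF.
Qed.

Lemma ltn_rank (i j : 'I_n) : i \in S -> i < j -> rank i < rank j.
Proof.
move=> iS ij; apply/proper_card/properP; split.
  by apply/subsetP=> k; rewrite !inE => /andP[-> /ltn_trans ->].
by exists i; rewrite !inE ?iS // ltnn andbF.
Qed.

Lemma rank_inj : {in S &, injective rank}.
Proof.
move=> i j iS jS eq_rank; apply/val_inj/eqP.
case: ltngtP => // [/(ltn_rank iS)|/(ltn_rank jS)]; rewrite eq_rank ltnn //.
Qed.

Lemma rank_surj k : k < #|S| -> exists2 i, i \in S & rank i = k.
Proof.
(* Read through the enumeration of [S], [rank] is an injective self-map of a finite type, hence
   onto. *)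
move=> lt_k; pose f (j : 'I_#|S|) := Ordinal (rank_lt (enum_valP j)).
have f_inj : injective f.
  by move=> j j' [] /rank_inj eqj; apply: enum_val_inj; rewrite eqj ?enum_valP.
have [g _ gK] := injF_bij f_inj.
exists (enum_val (g (Ordinal lt_k))); first exact: enum_valP.
exact: (congr1 val (gK (Ordinal lt_k))).
Qed.

End Rank.

Section SumSummand.
Variables (r1 r2 : rule) (n : nat) (L : splitting (rule_sum r1 r2) n).

Definition splitting_l : splitting r1 n.
Proof.
apply: (@Splitting r1 n (fun v => index_in L (inl v)) (fun v => index_out L (inl v))).
- by move=> e; exact: (index_in_edge L (inl e)).
- by move=> e; exact: (index_out_edge L (inl e)).
- by move=> [a b] ab; apply: (@index_rule _ _ L (inl a, inl b)); rewrite inE.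
Defined.

Definition splitting_r : splitting r2 n.
Proof.
apply: (@Splitting r2 n (fun v => index_in L (inr v)) (fun v => index_out L (inr v))).
- by move=> e; exact: (index_in_edge L (inr e)).
- by move=> e; exact: (index_out_edge L (inr e)).
- by move=> [a b] ab; apply: (@index_rule _ _ L (inr a, inr b)); rewrite inE.
Defined.

Lemma sum_sig_bij (S T : Type) (P : pred (S + T)) :
  bijective (fun x : {s | P (inl s)} + {t | P (inr t)} =>
    match x with
    | inl s => exist P (inl (val s)) (valP s)
    | inr t => exist P (inr (val t)) (valP t)
    end).
Proof.
exists (fun x : {x | P x} => match x with
  | exist (inl s) Ps => inl (exist _ s Ps)
  | exist (inr t) Pt => inr (exist _ t Pt) end).
- by move=> [[s Ps]|[t Pt]]; [congr inl | congr inr]; exact: val_inj.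
- by move=> [[s|t] Px]; exact: val_inj.
Qed.

(** Each constituent of a disjoint union is itself the disjoint union of its traces on the two
    halves; connectedness will force one trace to be empty. *)
Lemma summand_sum i :
  rule_iso (rule_sum (summand splitting_l i) (summand splitting_r i)) (summand L i).
Proof.
do 4!eexists; split; [split | split | | ].
all: try exact: sum_sig_bij.
- by move=> [e|e]; apply: val_inj.
- by move=> [e|e]; apply: val_inj.
- by move=> [e|e]; apply: val_inj.
- by move=> [e|e]; apply: val_inj.
- by move=> [a|a] [b|b]; rewrite !inE /= ?inE.
- by move=> [a|a] [b|b]; rewrite !inE /= ?inE.
Qed.

End SumSummand.

Lemma summand_linear r n (L : splitting r n) i : linear_rule r -> linear_rule (summand L i).
Proof.
move=> [rV rE rVE]; split.
- move=> [a b] [a' b']; rewrite !inE /= => ab ab' neq.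
  by have [] := rV _ _ ab ab'.
- move=> [a b] [a' b']; rewrite !inE /= => ab ab' neq.
  by have [] := rE _ _ ab ab'.
- by move=> e e'; rewrite !inE /= => /rVE.
Qed.

Lemma linear_rule_sum_inv r1 r2 :
  linear_rule (rule_sum r1 r2) -> linear_rule r1 /\ linear_rule r2.
Proof.
move=> [/one_to_one_block_inv[? ?] /one_to_one_block_inv[? ?] rVE]; split; split=> // e e' ee'.
- by have := rVE (inl e) (inl e'); rewrite !inE; apply.
- by have := rVE (inr e) (inr e'); rewrite !inE; apply.
Qed.

(* By connectedness each constituent of the numbered union lies in A or in B;
   those in A are renumbered by their rank among the indices used in A. *)
Lemma diagram_sum_rule_diagram_l A B :
  is_rule_diagram (diagram_sum A B) -> is_rule_diagram A.
Proof.
move=> rdAB; have [mV mE W] := coherent_compose_l (rule_diagram_coherent rdAB).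
have [lAB _ [n [L [Lc LV LE]]] _] := rdAB.
have [lA lB] := linear_rule_sum_inv lAB.
split=> //.
pose S := [set i | ~~ rule_empty (summand (splitting_l L) i)].
have right_empty i : i \in S -> rule_empty (summand (splitting_r L) i).
  rewrite inE => iS; apply: contrapT => /negP iR.
  have [_] := Lc i; case; exists (summand (splitting_l L) i), (summand (splitting_r L) i).
  split=> //; try exact: summand_linear.
  exact/rule_iso_sym/summand_sum.
have inS v : index_in L (inl v) \in S.
  rewrite inE; apply/negP=> /andP[/andP[/eqP/card0_eq + _] _].
  by move/(_ (exist _ v (eqxx _))).
have outS v : index_out L (inl v) \in S.
  rewrite inE; apply/negP=> /andP[_ /andP[/eqP/card0_eq + _]].
  by move/(_ (exist _ v (eqxx _))).
pose Fi v := Ordinal (rank_lt (inS v)); pose Fo v := Ordinal (rank_lt (outS v)).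
have Hi (e : edge (input A)) : Fi (source e) = Fi (target e).
  by apply: val_inj => /=; rewrite (index_in_edge L (inl e)).
have Ho (e : edge (output A)) : Fo (source e) = Fo (target e).
  by apply: val_inj => /=; rewrite (index_out_edge L (inl e)).
have Hr p : p \in ruleV A -> Fi p.1 = Fo p.2.
  case: p => a b ab; apply: val_inj => /=.
  by rewrite (@index_rule _ _ L (inl a, inl b)) ?inE.
exists #|S|, (Splitting Hi Ho Hr); split.
- move=> k; have [i iS ik] := rank_surj (ltn_ord k).
  have /andP[/andP[/eqP/card0_eq iV _] /andP[/eqP/card0_eq oV _]] := right_empty i iS.
  apply: connected_iso (Lc i); apply/rule_iso_sym.
  have rankE j : j \in S -> (j == i) = (rank S j == k :> nat).
    by move=> jS; rewrite -ik; apply/eqP/eqP => [->|/rank_inj->].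
  have iS' v : index_in L v == i -> exists u, inl u = v.
    by case: v => v vi; [exists v | have := iV (exist _ v vi)].
  have oS' v : index_out L v == i -> exists u, inl u = v.
    by case: v => v vi; [exists v | have := oV (exist _ v vi)].
  apply: (@summand_iso A (rule_sum A B) _ _ _ _ _ _ inl inl inl inl) => //=;
    try (by move=> ? ? []); try (by move=> ? ?; rewrite inE);
    try (by move=> v; rewrite rankE).
  + by move=> [e|e] /iS'[u //]; exists e.
  + by move=> [e|e] /oS'[u //]; exists e.
- move=> [b a] ba; apply: ltn_rank => //; apply: (LV (inl b, inl a)).
  by rewrite inE.
- move=> [b a] ba; apply: ltn_rank => //; apply: (LE (inl b, inl a)).
  by rewrite inE.
Qed.

Lemma diagram_sum_rule_diagram_r A B :
  is_rule_diagram (diagram_sum A B) -> is_rule_diagram B.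
Proof.
move=> rdAB; apply: (@diagram_sum_rule_diagram_l B A).
exact: is_rule_diagram_iso (diagram_sumC A B) rdAB.
Qed.

(** * Two-colourings and disjoint unions *)

Definition is_inl (A B : Type) (x : A + B) : bool := if x is inl _ then true else false.

Definition colouring (d : diagram) : finType :=
  ({ffun vertex (input d) -> bool} * {ffun vertex (output d) -> bool})%type.

(** Only vertices are coloured and only vertex relations constrained. Edges take the colour of their
    end points; for edge rules this uses that rules are graph morphisms, for edge matches
    [cut_omega]. *)
Definition cut (d : diagram) (c : colouring d) : Prop :=
  [/\ forall e : edge (input d), c.1 (source e) = c.1 (target e),
      forall e : edge (output d), c.2 (source e) = c.2 (target e),
      forall a b, (a, b) \in ruleV d -> c.1 a = c.2 b
    & forall b a, (b, a) \in matchV d -> c.2 b = c.1 a].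

Definition splits (d : diagram) (c : colouring d) (D1 D2 : diagram) : Prop :=
  exists iV iE oV oE, [/\ @diagram_isom (diagram_sum D1 D2) d iV iE oV oE,
    forall v, c.1 (iV v) = is_inl v & forall v, c.2 (oV v) = is_inl v].

Lemma diagram_isom_comp d1 d2 d3 iV iE oV oE iV' iE' oV' oE' :
  @diagram_isom d1 d2 iV iE oV oE -> @diagram_isom d2 d3 iV' iE' oV' oE' ->
  diagram_isom (iV' \o iV) (iE' \o iE) (oV' \o oV) (oE' \o oE).
Proof.
move=> [i mV mE] [i' mV' mE']; split; first exact: rule_isom_comp i i'.
- by move=> b a /=; rewrite mV' mV.
- by move=> b a /=; rewrite mE' mE.
Qed.

Lemma splits_iso d c D1 D2 : @splits d c D1 D2 -> diagram_iso (diagram_sum D1 D2) d.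
Proof. by move=> [iV [iE [oV [oE [i _ _]]]]]; exists iV, iE, oV, oE. Qed.

Lemma splits_isom d d' iV iE oV oE (c : colouring d) (c' : colouring d') D1 D2 :
  @diagram_isom d d' iV iE oV oE ->
  (forall v, c'.1 (iV v) = c.1 v) -> (forall v, c'.2 (oV v) = c.2 v) ->
  splits c D1 D2 -> splits c' D1 D2.
Proof.
move=> i ci co [iV' [iE' [oV' [oE' [i' ci' co']]]]].
exists (iV \o iV'), (iE \o iE'), (oV \o oV'), (oE \o oE'); split.
- exact: diagram_isom_comp i' i.
- by move=> v /=; rewrite ci.
- by move=> v /=; rewrite co.
Qed.

Lemma splits_cut d (c : colouring d) D1 D2 : splits c D1 D2 -> cut c.
Proof.
move=> [iV [iE [oV [oE [[[[iVb iEb iS iT] [oVb oEb oS oT] rV _] mV _] ci co]]]]].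
have [iV' _ iVK] := iVb; have [oV' _ oVK] := oVb.
have [iE' _ iEK] := iEb; have [oE' _ oEK] := oEb.
split.
- by move=> e; rewrite -(iEK e) iS iT !ci; case: (iE' e).
- by move=> e; rewrite -(oEK e) oS oT !co; case: (oE' e).
- move=> a b; rewrite -(iVK a) -(oVK b) rV ci co.
  by case: (iV' a) (oV' b) => [a'|a'] [b'|b']; rewrite !inE.
- move=> b a; rewrite -(iVK a) -(oVK b) mV ci co.
  by case: (iV' a) (oV' b) => [a'|a'] [b'|b']; rewrite !inE.
Qed.

(** Both presentations of [U] induce the same colouring, so the inverse of [g] after [f] preserves
    the summands and restricts to a bijection on each. *)
Lemma sum_bij_match (S T S' T' U : finType) (c : U -> bool)
    (f : S + T -> U) (g : S' + T' -> U) :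
  bijective f -> bijective g ->
  (forall x, c (f x) = is_inl x) -> (forall x, c (g x) = is_inl x) ->
  exists h : S -> S', exists k : T -> T',
    [/\ bijective h, bijective k, forall x, g (inl (h x)) = f (inl x)
      & forall x, g (inr (k x)) = f (inr x)].
Proof.
move=> [f' fK f'K] [g' gK g'K] cf cg.
have cg' u : is_inl (g' u) = c u by rewrite -cg g'K.
have cf' u : is_inl (f' u) = c u by rewrite -cf f'K.
have hP x : exists y, g (inl y) = f (inl x).
  by move: (cg' (f (inl x))) (g'K (f (inl x))); rewrite cf; case: (g' _) => // y _ <-; exists y.
have kP x : exists y, g (inr y) = f (inr x).
  by move: (cg' (f (inr x))) (g'K (f (inr x))); rewrite cf; case: (g' _) => // y _ <-; exists y.
exists (fun x => projT1 (cid (hP x))), (fun x => projT1 (cid (kP x))).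
split; try by move=> x; case: cid.
- apply: bij_of_inj_surj.
    move=> x y; case: cid => x' /= xx'; case: cid => y' /= yy' eq.
    by move: xx'; rewrite eq yy' => /(can_inj fK)[].
  move=> y; move: (cf' (g (inl y))) (f'K (g (inl y))); rewrite cg.
  case: (f' _) => // x _ fx; exists x; case: cid => y' /=; rewrite fx.
  by move=> /(can_inj gK)[].
- apply: bij_of_inj_surj.
    move=> x y; case: cid => x' /= xx'; case: cid => y' /= yy' eq.
    by move: xx'; rewrite eq yy' => /(can_inj fK)[].
  move=> y; move: (cf' (g (inr y))) (f'K (g (inr y))); rewrite cg.
  case: (f' _) => // x _ fx; exists x; case: cid => y' /=; rewrite fx.
  by move=> /(can_inj gK)[].
Qed.

Lemma graph_sum_match G1 G2 G1' G2' H (c : vertex H -> bool) fV fE gV gE :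
  @graph_isom (graph_sum G1 G2) H fV fE -> @graph_isom (graph_sum G1' G2') H gV gE ->
  (forall v, c (fV v) = is_inl v) -> (forall v, c (gV v) = is_inl v) ->
  exists hV hE kV kE, [/\ @graph_isom G1 G1' hV hE, @graph_isom G2 G2' kV kE,
    (forall v, gV (inl (hV v)) = fV (inl v)) /\ (forall v, gV (inr (kV v)) = fV (inr v))
    & (forall e, gE (inl (hE e)) = fE (inl e)) /\ (forall e, gE (inr (kE e)) = fE (inr e))].
Proof.
move=> [fVb fEb fS fT] [gVb gEb gS gT] cf cg.
have cfE e : c (source (fE e)) = is_inl e by rewrite fS cf; case: e.
have cgE e : c (source (gE e)) = is_inl e by rewrite gS cg; case: e.
have [hV [kV [hVb kVb hVE kVE]]] := sum_bij_match fVb gVb cf cg.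
(* Edges are coloured by their source. *)
have [hE [kE [hEb kEb hEE kEE]]] :=
  sum_bij_match (c := fun e => c (source e)) fEb gEb cfE cgE.
have gVI := bij_inj gVb.
exists hV, hE, kV, kE; split; try by split.
- split=> // e.
  + have /gVI[//] : gV (inl (source (hE e))) = gV (inl (hV (source e))).
    by rewrite -(gS (inl (hE e))) hEE fS hVE.
  + have /gVI[//] : gV (inl (target (hE e))) = gV (inl (hV (target e))).
    by rewrite -(gT (inl (hE e))) hEE fT hVE.
- split=> // e.
  + have /gVI[//] : gV (inr (source (kE e))) = gV (inr (kV (source e))).
    by rewrite -(gS (inr (kE e))) kEE fS kVE.
  + have /gVI[//] : gV (inr (target (kE e))) = gV (inr (kV (target e))).
    by rewrite -(gT (inr (kE e))) kEE fT kVE.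
Qed.

(** This makes the tensor attached to a colouring independent of the decomposition chosen to compute
    it. *)
Lemma splits_uniq d (c : colouring d) D1 D2 D1' D2' :
  splits c D1 D2 -> splits c D1' D2' -> diagram_iso D1 D1' /\ diagram_iso D2 D2'.
Proof.
move=> [iV [iE [oV [oE [[[i o rV rE] mV mE] ci co]]]]].
move=> [iV' [iE' [oV' [oE' [[[i' o' rV' rE'] mV' mE'] ci' co']]]]].
have [hiV [hiE [kiV [kiE [hi ki [hiVE kiVE] [hiEE kiEE]]]]]] := graph_sum_match i i' ci ci'.
have [hoV [hoE [koV [koE [ho ko [hoVE koVE] [hoEE koEE]]]]]] := graph_sum_match o o' co co'.
split; [exists hiV, hiE, hoV, hoE | exists kiV, kiE, koV, koE]; split; try split=> //.
- by move=> a b; have := rV' (inl (hiV a)) (inl (hoV b)); rewrite hiVE hoVE rV !inE.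
- by move=> a b; have := rE' (inl (hiE a)) (inl (hoE b)); rewrite hiEE hoEE rE !inE.
- by move=> b a; have := mV' (inl (hoV b)) (inl (hiV a)); rewrite hiVE hoVE mV !inE.
- by move=> b a; have := mE' (inl (hoE b)) (inl (hiE a)); rewrite hiEE hoEE mE !inE.
- by move=> a b; have := rV' (inr (kiV a)) (inr (koV b)); rewrite kiVE koVE rV !inE.
- by move=> a b; have := rE' (inr (kiE a)) (inr (koE b)); rewrite kiEE koEE rE !inE.
- by move=> b a; have := mV' (inr (koV b)) (inr (kiV a)); rewrite kiVE koVE mV !inE.
- by move=> b a; have := mE' (inr (koE b)) (inr (kiE a)); rewrite kiEE koEE mE !inE.
Qed.

(** Matches and rules both preserve the colour, so it is constant along the paths that make up
    [omega]. *)
Lemma cut_omega d (c : colouring d) b a :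
  cut c -> (b, a) \in omega (ruleV d) (matchV d) -> c.2 b = c.1 a.
Proof.
move=> [_ _ cr cm]; rewrite inE /= => /existsP[b' /andP[]]; rewrite inE /= => bb' /cm <-.
apply: (connect_inv (P := fun x => c.2 b = c.2 x)) bb' => // x y ->.
by rewrite /= inE => /existsP[i /andP[/cm-> /cr->]].
Qed.

Lemma merge_bij (T : finType) (f : T -> 'I_2) :
  bijective (fun x : {t | f t == ord0} + {t | f t == ord_max} =>
    match x with inl t => val t | inr t => val t end).
Proof.
apply: bij_of_inj_surj.
  move=> [[x fx]|[x fx]] [[y fy]|[y fy]] /= xy.
  - by congr inl; exact: val_inj.
  - by exfalso; move: (eqP fx); rewrite xy (eqP fy).
  - by exfalso; move: (eqP fx); rewrite xy (eqP fy).
  - by congr inr; exact: val_inj.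
move=> t; have [ft|ft] : f t == ord0 \/ f t == ord_max.
  by case: (f t) => -[|[|//]] lt; [left | right].
- by exists (inl (exist _ t ft)).
- by exists (inr (exist _ t ft)).
Qed.

(** The colour classes are the two summands of a splitting indexed by ['I_2]. They are rule diagrams
    because their disjoint union is isomorphic to [d]. *)
Lemma cut_splits d (c : colouring d) : is_rule_diagram d -> cut c ->
  exists D1 D2 : rule_diagram, splits c D1 D2.
Proof.
move=> rd cutc; have [ci co cr cm] := cutc.
have [[_ _ rVE] _ _ W] := rd.
pose col (b : bool) : 'I_2 := if b then ord0 else ord_max.
have col0 b : col b == ord0 -> b by case: b.
have col1 b : col b == ord_max -> b = false by case: b.
have Hi (e : edge (input d)) : col (c.1 (source e)) = col (c.1 (target e)) by rewrite ci.
have Ho (e : edge (output d)) : col (c.2 (source e)) = col (c.2 (target e)) by rewrite co.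
have Hr p : p \in ruleV d -> col (c.1 p.1) = col (c.2 p.2) by case: p => a b /cr ->.
pose L := @Splitting d 2 (fun v => col (c.1 v)) (fun v => col (c.2 v)) Hi Ho Hr.
pose part i := @Diagram (summand L i) [set p | (val p.1, val p.2) \in matchV d]
  [set p | (val p.1, val p.2) \in matchE d].
have sp : splits c (part ord0) (part ord_max).
  do 4!eexists; split; [split; [split; [split | split | | ] | | ] | | ].
  all: try exact: (merge_bij).
  - by move=> [e|e].
  - by move=> [e|e].
  - by move=> [e|e].
  - by move=> [e|e].
  - move=> [[a ha]|[a ha]] [[b hb]|[b hb]]; rewrite !inE //=;
      apply/negP => /cr; rewrite (col0 _ ha) (col1 _ hb) || rewrite (col1 _ ha) (col0 _ hb);
      done.
  - move=> [[a ha]|[a ha]] [[b hb]|[b hb]]; rewrite !inE //=;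
      apply/negP => /rVE[/cr + _];
      rewrite (col0 _ ha) (col1 _ hb) || rewrite (col1 _ ha) (col0 _ hb);
      done.
  - move=> [[b hb]|[b hb]] [[a ha]|[a ha]]; rewrite !inE //=;
      apply/negP => /cm; rewrite (col0 _ ha) (col1 _ hb) || rewrite (col1 _ ha) (col0 _ hb);
      done.
  (* The sources of matched edges need not be matched themselves; they are only joined by an [omega]
     path, which still preserves the colour. *)
  - have mE b a : (b, a) \in matchE d -> c.2 (source b) = c.1 (source a).
      move=> ba; apply: cut_omega => //; apply: (W b a _).1; rewrite inE.
      by apply/existsP; exists b; rewrite ba andbT inE connect0.
    move=> [[b hb]|[b hb]] [[a ha]|[a ha]]; rewrite !inE //=;
      apply/negP => /mE; rewrite (col0 _ ha) (col1 _ hb) || rewrite (col1 _ ha) (col0 _ hb);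
      done.
  - by move=> [[v hv]|[v hv]] /=; [exact: col0 hv | exact: col1 hv].
  - by move=> [[v hv]|[v hv]] /=; [exact: col0 hv | exact: col1 hv].
have rds := is_rule_diagram_iso (diagram_iso_sym (splits_iso sp)) rd.
exists (RuleDiagram (diagram_sum_rule_diagram_l rds)).
by exists (RuleDiagram (diagram_sum_rule_diagram_r rds)).
Qed.

(** * Matches of composites and of disjoint unions *)

Section RelationBijections.

Definition pull_rel (A A' B B' : finType) (f : A -> A') (g : B -> B')
    (R : {set A' * B'}) : {set A * B} :=
  [set p | (f p.1, g p.2) \in R].

Lemma pull_rel_bij (A A' B B' : finType) (f : A -> A') (g : B -> B') :
  bijective f -> bijective g -> bijective (pull_rel f g).
Proof.
move=> [f' fK f'K] [g' gK g'K]; exists (pull_rel f' g') => R.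
- by apply/setP=> -[a b]; rewrite !inE /= f'K g'K.
- by apply/setP=> -[a b]; rewrite !inE /= fK gK.
Qed.

Definition rel_row (A B C : finType) (p : {set C * A} * {set C * B}) : {set C * (A + B)} :=
  [set q | match q.2 with inl a => (q.1, a) \in p.1 | inr b => (q.1, b) \in p.2 end].

Definition rel_col (A B C : finType) (p : {set A * C} * {set B * C}) : {set (A + B) * C} :=
  [set q | match q.1 with inl a => (a, q.2) \in p.1 | inr b => (b, q.2) \in p.2 end].

Lemma rel_row_bij (A B C : finType) : bijective (@rel_row A B C).
Proof.
exists (fun R => (pull_rel id inl R, pull_rel id inr R)).
- by move=> [R S]; congr (_, _); apply/setP=> -[a b]; rewrite !inE /= ?inE.
- by move=> R; apply/setP=> -[c [a|b]]; rewrite !inE /= ?inE.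
Qed.

Lemma rel_col_bij (A B C : finType) : bijective (@rel_col A B C).
Proof.
exists (fun R => (pull_rel inl id R, pull_rel inr id R)).
- by move=> [R S]; congr (_, _); apply/setP=> -[a b]; rewrite !inE /= ?inE.
- by move=> R; apply/setP=> -[[a|b] c]; rewrite !inE /= ?inE.
Qed.

End RelationBijections.

(** All pairs of relations are allowed, whether or not the composite is a rule diagram, so that sums
    range over a full product type and can be reindexed by bijections. *)
Definition gmatch (A B : diagram) : finType :=
  ({set vertex (output B) * vertex (input A)} * {set edge (output B) * edge (input A)})%type.

Definition mcompose (A B : diagram) (m : gmatch A B) : diagram := compose m.1 m.2.

Lemma compose_isom A A' B B' iV iE oV oE jV jE pV pE (m : gmatch A' B') :
  @diagram_isom A A' iV iE oV oE -> @diagram_isom B B' jV jE pV pE ->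
  @diagram_isom (@mcompose A B (pull_rel pV iV m.1, pull_rel pE iE m.2)) (mcompose m)
    (sum_map iV jV) (sum_map iE jE) (sum_map oV pV) (sum_map oE pE).
Proof.
move=> [[[? ? iS iT] [? ? oS oT] rV rE] mV mE] [[[? ? jS jT] [? ? pS pT] rV' rE'] mV' mE'].
split; [split; [split | split | | ] | |]; try exact: sum_map_bij.
- by move=> [e|e] /=; rewrite ?iS ?jS.
- by move=> [e|e] /=; rewrite ?iT ?jT.
- by move=> [e|e] /=; rewrite ?oS ?pS.
- by move=> [e|e] /=; rewrite ?oT ?pT.
- by move=> [a|a] [b|b]; rewrite !inE /= ?inE ?(rV, rV').
- by move=> [a|a] [b|b]; rewrite !inE /= ?inE ?(rE, rE').
- by move=> [a|a] [b|b]; rewrite !inE /= ?inE ?(mV, mV').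
- by move=> [a|a] [b|b]; rewrite !inE /= ?inE ?(mE, mE').
Qed.

Definition row_match A B C (m : gmatch A B) (p : gmatch A C * gmatch B C) :
    gmatch (mcompose m) C :=
  (rel_row (p.1.1, p.2.1), rel_row (p.1.2, p.2.2)).

Definition col_match A B C (m : gmatch B C) (p : gmatch A B * gmatch A C) :
    gmatch A (mcompose m) :=
  (rel_col (p.1.1, p.2.1), rel_col (p.1.2, p.2.2)).

Lemma row_match_bij A B C (m : gmatch A B) : bijective (@row_match A B C m).
Proof.
have [f fK f'K] := rel_row_bij (vertex (input A)) (vertex (input B)) (vertex (output C)).
have [g gK g'K] := rel_row_bij (edge (input A)) (edge (input B)) (edge (output C)).
exists (fun q => (((f q.1).1, (g q.2).1), ((f q.1).2, (g q.2).2))).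
- by move=> [[a b] [c d]]; rewrite /row_match /= fK gK.
- by move=> [a b]; rewrite /row_match /= -!surjective_pairing f'K g'K.
Qed.

Lemma col_match_bij A B C (m : gmatch B C) : bijective (@col_match A B C m).
Proof.
have [f fK f'K] := rel_col_bij (vertex (output B)) (vertex (output C)) (vertex (input A)).
have [g gK g'K] := rel_col_bij (edge (output B)) (edge (output C)) (edge (input A)).
exists (fun q => (((f q.1).1, (g q.2).1), ((f q.1).2, (g q.2).2))).
- by move=> [[a b] [c d]]; rewrite /col_match /= fK gK.
- by move=> [a b]; rewrite /col_match /= -!surjective_pairing f'K g'K.
Qed.

(** Either bracketing of a triple composite amounts to the same three pairwise matches, which is the
    source of associativity. *)
Lemma mcomposeA A B C (mAB : gmatch A B) (mAC : gmatch A C) (mBC : gmatch B C) :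
  diagram_iso (mcompose (col_match mBC (mAB, mAC))) (mcompose (row_match mAB (mAC, mBC))).
Proof.
exists (@sum_assoc _ _ _), (@sum_assoc _ _ _), (@sum_assoc _ _ _), (@sum_assoc _ _ _).
split; [split; [split | split | | ] | |]; try exact: sum_assoc_bij;
  try (by move=> [|[]]); by move=> [a|[a|a]] [b|[b|b]]; rewrite !inE /= ?inE.
Qed.

Section Colourings.
Variables A B : diagram.

Definition join (m : gmatch A B) (p : colouring A * colouring B) : colouring (mcompose m) :=
  ([ffun v => match v with inl a => p.1.1 a | inr b => p.2.1 b end],
   [ffun v => match v with inl a => p.1.2 a | inr b => p.2.2 b end]).

Lemma join_bij m : bijective (join m).
Proof.
exists (fun c : colouring (mcompose m) =>
  (([ffun a => c.1 (inl a)], [ffun a => c.2 (inl a)]) : colouring A,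
   ([ffun b => c.1 (inr b)], [ffun b => c.2 (inr b)]) : colouring B)).
- move=> [[c1 c2] [c3 c4]]; rewrite /join /=; congr (_, _, (_, _));
    by apply/ffunP=> v; rewrite !ffunE.
- move=> [c1 c2]; rewrite /join /=; congr (_, _);
    by apply/ffunP=> -[v|v]; rewrite !ffunE.
Qed.

Lemma cut_join m p : cut (join m p) -> cut p.1 /\ cut p.2.
Proof.
move=> [ci co cr cm]; split; split.
- by move=> e; have := ci (inl e); rewrite !ffunE.
- by move=> e; have := co (inl e); rewrite !ffunE.
- by move=> a b ab; have := cr (inl a) (inl b); rewrite !ffunE !inE; apply.
- by move=> b a ba; have := cm (inl b) (inl a); rewrite !ffunE !inE; apply.
- by move=> e; have := ci (inr e); rewrite !ffunE.
- by move=> e; have := co (inr e); rewrite !ffunE.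
- by move=> a b ab; have := cr (inr a) (inr b); rewrite !ffunE !inE; apply.
- by move=> b a ba; have := cm (inr b) (inr a); rewrite !ffunE !inE; apply.
Qed.

Definition side : colouring (diagram_sum A B) := ([ffun v => is_inl v], [ffun v => is_inl v]).

End Colourings.

Definition diag_match A1 A2 B1 B2 (p : gmatch A1 B1 * gmatch A2 B2) :
    gmatch (diagram_sum A1 A2) (diagram_sum B1 B2) :=
  (rel_block p.1.1 set0 p.2.1, rel_block p.1.2 set0 p.2.2).

Definition diag_blocks A1 A2 B1 B2 (m : gmatch (diagram_sum A1 A2) (diagram_sum B1 B2)) :
    gmatch A1 B1 * gmatch A2 B2 :=
  ((pull_rel inl inl m.1, pull_rel inl inl m.2), (pull_rel inr inr m.1, pull_rel inr inr m.2)).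

Lemma diag_matchK A1 A2 B1 B2 : cancel (@diag_match A1 A2 B1 B2) (@diag_blocks A1 A2 B1 B2).
Proof.
by move=> [[a b] [c d]]; congr (_, _, (_, _)); apply/setP=> -[x y]; rewrite !inE.
Qed.

Definition sum_interchange (A B C D : Type) (x : (A + B) + (C + D)) : (A + C) + (B + D) :=
  match x with
  | inl (inl a) => inl (inl a)
  | inl (inr b) => inr (inl b)
  | inr (inl c) => inl (inr c)
  | inr (inr d) => inr (inr d)
  end.

Lemma sum_interchange_bij A B C D : bijective (@sum_interchange A B C D).
Proof. by exists (@sum_interchange A C B D) => -[[]|[]]. Qed.

(** Interchanging the two middle summands groups the parts of equal colour; a block-diagonal match
    creates no link between the groups. *)
Lemma splits_diag_match A1 A2 B1 B2 (p : gmatch A1 B1 * gmatch A2 B2) :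
  splits (join (diag_match p) (side A1 A2, side B1 B2)) (mcompose p.1) (mcompose p.2).
Proof.
exists (@sum_interchange _ _ _ _), (@sum_interchange _ _ _ _),
  (@sum_interchange _ _ _ _), (@sum_interchange _ _ _ _).
split; last 1 first.
- by move=> [[v|v]|[v|v]]; rewrite !ffunE /= ?ffunE.
- split; [split; [split | split | | ] | |]; try exact: sum_interchange_bij;
    try (by move=> [[]|[]]);
    by move=> [[a|a]|[a|a]] [[b|b]|[b|b]]; rewrite !inE /= ?inE.
- by move=> [[v|v]|[v|v]]; rewrite !ffunE /= ?ffunE.
Qed.

(** Vertex matches preserve the colour by [cut], edge matches by [cut_omega], so the off-diagonal
    blocks of [m] are empty. *)
Lemma cut_diag_match A1 A2 B1 B2 (m : gmatch (diagram_sum A1 A2) (diagram_sum B1 B2)) :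
  is_rule_diagram (mcompose m) -> cut (join m (side A1 A2, side B1 B2)) ->
  diag_match (diag_blocks m) = m.
Proof.
move=> rd cutm; have [_ _ _ cm] := cutm; have [_ _ _ W] := rd.
have cV b a : (b, a) \in m.1 -> is_inl b = is_inl a.
  by move=> ba; have := cm (inr b) (inl a); rewrite !ffunE /= ?ffunE inE => /(_ ba).
have cE b a : (b, a) \in m.2 -> is_inl b = is_inl a.
  move=> ba; have : (inr b, inl a) \in omega (ruleE (mcompose m)) (matchE (mcompose m)).
    by rewrite inE; apply/existsP; exists (inr b); rewrite !inE connect0.
  by move=> /W[/(cut_omega cutm)]; rewrite /= !ffunE /= ?ffunE; case: b a {ba} => [b|b] [a|a].
rewrite [RHS]surjective_pairing; congr (_, _); apply/setP=> -[[b|b] [a|a]]; rewrite !inE //=.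
- by apply/esym/negbTE/negP=> /cV.
- by apply/esym/negbTE/negP=> /cV.
- by apply/esym/negbTE/negP=> /cE.
- by apply/esym/negbTE/negP=> /cE.
Qed.

(** Pulling matches back along the two isomorphisms reduces arbitrary decomposing colourings to the
    colouring by [side]. The clause on empty relations serves the disjoint union of A and B. *)
Lemma splits_join A B A1 A2 B1 B2 (c : colouring A) (c' : colouring B) :
  splits c A1 A2 -> splits c' B1 B2 ->
  exists2 f : gmatch A B -> gmatch (diagram_sum A1 A2) (diagram_sum B1 B2),
    bijective f & (f (set0, set0) = (set0, set0)) /\ forall m, exists iV iE oV oE,
      [/\ @diagram_isom (mcompose (f m)) (mcompose m) iV iE oV oE,
          forall v, (join m (c, c')).1 (iV v) = (join (f m) (side A1 A2, side B1 B2)).1 v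
        & forall v, (join m (c, c')).2 (oV v) = (join (f m) (side A1 A2, side B1 B2)).2 v].
Proof.
move=> [iV [iE [oV [oE [i ci co]]]]] [jV [jE [pV [pE [j cj cp]]]]].
have [[[iVb iEb _ _] _ _ _] _ _] := i; have [[_ [pVb pEb _ _] _ _] _ _] := j.
exists (fun m => (pull_rel pV iV m.1, pull_rel pE iE m.2)).
  have [f fK f'K] := pull_rel_bij pVb iVb; have [g gK g'K] := pull_rel_bij pEb iEb.
  exists (fun m => (f m.1, g m.2)) => -[x y] /=; first by rewrite fK gK.
  by rewrite f'K g'K.
split=> [|m]; first by congr (_, _); apply/setP=> x; rewrite !inE.
exists (sum_map iV jV), (sum_map iE jE), (sum_map oV pV), (sum_map oE pE); split.
- exact: compose_isom.
- by move=> [v|v]; rewrite !ffunE /= ?ffunE ?ci ?cj.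
- by move=> [v|v]; rewrite !ffunE /= ?ffunE ?co ?cp.
Qed.

Local Open Scope ring_scope.

(** * Tensor products, convolution and antipodes *)

Section TensorMaps.
Variable K : fieldType.
Local Notation F X := {freeg X%type / K}.

Lemma tensDl (X Y : choiceType) (u u' : F X) (v : F Y) :
  tens (u + u') v = tens u v + tens u' v.
Proof. by have := tens_linear_l v 1 u u'; rewrite !scale1r. Qed.

Lemma tensDr (X Y : choiceType) (u : F X) (v v' : F Y) :
  tens u (v + v') = tens u v + tens u v'.
Proof. by have := tens_linear_r u 1 v v'; rewrite !scale1r. Qed.

Lemma tens0l (X Y : choiceType) (v : F Y) : tens (0 : F X) v = 0.
Proof. by rewrite /tens raddf0. Qed.

Lemma tens0r (X Y : choiceType) (u : F X) : tens u (0 : F Y) = 0.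
Proof. by apply: (addrI (tens u 0)); rewrite -tensDr !addr0. Qed.

Lemma tensZl (X Y : choiceType) k (u : F X) (v : F Y) :
  tens (k *: u) v = k *: tens u v.
Proof. by have := tens_linear_l v k u 0; rewrite tens0l !addr0. Qed.

Lemma tensZr (X Y : choiceType) k (u : F X) (v : F Y) :
  tens u (k *: v) = k *: tens u v.
Proof. by have := tens_linear_r u k v 0; rewrite tens0r !addr0. Qed.

Lemma tens_suml (X Y : choiceType) I (r : seq I) (P : pred I) (f : I -> F X) (v : F Y) :
  tens (\sum_(i <- r | P i) f i) v = \sum_(i <- r | P i) tens (f i) v.
Proof. exact: (big_morph (fun u : F X => tens u v) (fun u u' => tensDl u u' v) (tens0l X v)). Qed.

Lemma tens_sumr (X Y : choiceType) I (r : seq I) (P : pred I) (u : F X) (f : I -> F Y) :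
  tens u (\sum_(i <- r | P i) f i) = \sum_(i <- r | P i) tens u (f i).
Proof. exact: (big_morph (fun v : F Y => tens u v) (tensDr u) (tens0r Y u)). Qed.

Lemma tens_mapE (X Y X' Y' : choiceType) (f : {linear F X -> F X'})
    (g : {linear F Y -> F Y'}) u v :
  tens_map f g (tens u v) = tens (f u) (g v).
Proof.
apply: (eq_on_basis (f := fun u => tens_map f g (tens u v))
                    (g := fun u => tens (f u) (g v))).
- by move=> c u1 u2; rewrite tens_linear_l linearP.
- by move=> c u1 u2; rewrite linearP tens_linear_l.
move=> x; apply: (eq_on_basis (f := fun v => tens_map f g (tens << x >> v))
                    (g := fun v => tens (f << x >>) (g v))).
- by move=> c u1 u2; rewrite tens_linear_r linearP.
- by move=> c u1 u2; rewrite linearP tens_linear_r.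
by move=> y; rewrite tensU /tens_map /= linextU.
Qed.

Lemma tens_mapU (X Y X' Y' : choiceType) (f : {linear F X -> F X'})
    (g : {linear F Y -> F Y'}) p :
  tens_map f g << p >> = tens (f << p.1 >>) (g << p.2 >>).
Proof. by rewrite /tens_map /= linextU. Qed.

Lemma tens_map_comp (X Y X' Y' X'' Y'' : choiceType)
    (f : {linear F X' -> F X''}) (g : {linear F Y' -> F Y''})
    (f' : {linear F X -> F X'}) (g' : {linear F Y -> F Y'})
    (h : {linear F X -> F X''}) (k : {linear F Y -> F Y''}) :
  (forall x, f (f' x) = h x) -> (forall x, g (g' x) = k x) ->
  forall w, tens_map f g (tens_map f' g' w) = tens_map h k w.
Proof.
move=> fh gk; apply: (linear_freeg_eq (f := tens_map f g \o tens_map f' g')) => p.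
by rewrite -[LHS]/(tens_map f g (tens_map f' g' << p >>)) tens_mapU tens_mapE fh gk tens_mapU.
Qed.

Lemma eq_tens_map (X Y X' Y' : choiceType) (f f' : {linear F X -> F X'})
    (g g' : {linear F Y -> F Y'}) :
  f =1 f' -> g =1 g' -> tens_map f g =1 tens_map f' g'.
Proof.
by move=> ff' gg'; apply: linear_freeg_eq => p; rewrite !tens_mapU ff' gg'.
Qed.

Lemma tens_map_id (X Y : choiceType) :
  @tens_map K X Y X Y idfun idfun =1 idfun.
Proof. by apply: linear_freeg_eq => p; rewrite tens_mapU tensU -surjective_pairing. Qed.

Lemma tens_mapDl (X Y X' Y' : choiceType) (f f' : {linear F X -> F X'})
    (g : {linear F Y -> F Y'}) w :
  tens_map (f \+ f') g w = tens_map f g w + tens_map f' g w.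
Proof.
move: w; apply: (linear_freeg_eq (f := tens_map (f \+ f') g)
  (g := tens_map f g \+ tens_map f' g)) => p.
rewrite -[RHS]/(tens_map f g << p >> + tens_map f' g << p >>).
by rewrite !tens_mapU -tensDl.
Qed.

Lemma tens_mapDr (X Y X' Y' : choiceType) (f : {linear F X -> F X'})
    (g g' : {linear F Y -> F Y'}) w :
  tens_map f (g \+ g') w = tens_map f g w + tens_map f g' w.
Proof.
move: w; apply: (linear_freeg_eq (f := tens_map f (g \+ g'))
  (g := tens_map f g \+ tens_map f g')) => p.
rewrite -[RHS]/(tens_map f g << p >> + tens_map f g' << p >>).
by rewrite !tens_mapU -tensDr.
Qed.

Lemma tens_assocE (X Y Z : choiceType) (u : F X) (v : F Y) (w : F Z) :
  tens_assoc K X Y Z (tens (tens u v) w) = tens u (tens v w).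
Proof.
apply: (eq_on_basis (f := fun u => tens_assoc K X Y Z (tens (tens u v) w))
                    (g := fun u => tens u (tens v w))).
- by move=> c u1 u2; rewrite !tens_linear_l linearP.
- by move=> c u1 u2; rewrite tens_linear_l.
move=> x; apply: (eq_on_basis (f := fun v => tens_assoc K X Y Z (tens (tens << x >> v) w))
                    (g := fun v => tens << x >> (tens v w))).
- by move=> c u1 u2; rewrite tens_linear_r tens_linear_l linearP.
- by move=> c u1 u2; rewrite tens_linear_l tens_linear_r.
move=> y; apply: (eq_on_basis (f := fun w => tens_assoc K X Y Z (tens (tens << x >> << y >>) w))
                    (g := fun w => tens << x >> (tens << y >> w))).
- by move=> c u1 u2; rewrite tens_linear_r linearP.
- by move=> c u1 u2; rewrite !tens_linear_r.
by move=> z; rewrite !tensU /tens_assoc /= linextU.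
Qed.

Lemma tens_assoc_map (X Y Z X' Y' Z' : choiceType) (f : {linear F X -> F X'})
    (g : {linear F Y -> F Y'}) (h : {linear F Z -> F Z'}) w :
  tens_assoc K X' Y' Z' (tens_map (tens_map f g) h w) =
  tens_map f (tens_map g h) (tens_assoc K X Y Z w).
Proof.
move: w; apply: (linear_freeg_eq (f := tens_assoc K X' Y' Z' \o tens_map (tens_map f g) h)
                         (g := tens_map f (tens_map g h) \o tens_assoc K X Y Z)) => -[[x y] z].
rewrite -[LHS]/(tens_assoc K X' Y' Z' (tens_map (tens_map f g) h << (x, y, z) >>)).
rewrite -[RHS]/(tens_map f (tens_map g h) (tens_assoc K X Y Z << (x, y, z) >>)).
by rewrite -!tensU !(tens_mapE, tens_assocE).
Qed.

End TensorMaps.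

(** * Convolution powers *)

Section Convolution.
Variables (K : fieldType) (X : choiceType).
Local Notation H := {freeg X / K}.
Variables (mu : {linear {freeg (X * X)%type / K} -> H}) (eta : {linear K^o -> H}).
Variables (Delta : {linear H -> {freeg (X * X)%type / K}}) (eps : {linear H -> K^o}).
Hypothesis alg : is_algebra mu eta.
Hypothesis coalg : is_coalgebra Delta eps.

Definition conv (f g : {linear H -> H}) : {linear H -> H} :=
  mu \o tens_map f g \o Delta.

Lemma convE f g d : conv f g d = mu (tens_map f g (Delta d)).
Proof. by []. Qed.

Lemma eq_conv (f f' g g' : {linear H -> H}) : f =1 f' -> g =1 g' -> conv f g =1 conv f' g'.
Proof. by move=> ff' gg' d; rewrite !convE (eq_tens_map ff' gg'). Qed.

Lemma convA f g h : conv (conv f g) h =1 conv f (conv g h).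
Proof.
have [muA _ _] := alg; have [DA _ _] := coalg.
move=> d; rewrite !convE.
rewrite -(@tens_map_comp K _ _ _ _ _ _ mu idfun (tens_map f g \o Delta) h) //.
rewrite -(@tens_map_comp K _ _ _ _ _ _ (tens_map f g) h Delta idfun) //.
rewrite muA tens_assoc_map DA.
rewrite (@tens_map_comp K _ _ _ _ _ _ f (tens_map g h) idfun Delta f (tens_map g h \o Delta)) //.
by rewrite (@tens_map_comp K _ _ _ _ _ _ idfun mu f (tens_map g h \o Delta) f (conv g h)).
Qed.

Lemma conv1f f : conv (eta \o eps) f =1 f.
Proof.
have [_ mu1 _] := alg; have [_ D1 _] := coalg.
(* Once [d] on the right is written as a contraction of [Delta d], that tensor can be generalized
   and the identity checked on basis pairs. *)
move=> d; rewrite convE -[in RHS](D1 d).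
move: (Delta d); apply: (linear_freeg_eq (f := mu \o tens_map (eta \o eps) f)
  (g := f \o contract_l X eps)) => p.
rewrite -[LHS]/(mu (tens_map (eta \o eps) f << p >>)) -[RHS]/(f (contract_l X eps << p >>)).
by rewrite tens_mapU [contract_l _ _ _]linextU mu1 linearZ.
Qed.

Lemma convf1 f : conv f (eta \o eps) =1 f.
Proof.
have [_ _ mu1] := alg; have [_ _ D1] := coalg.
move=> d; rewrite convE -[in RHS](D1 d).
move: (Delta d); apply: (linear_freeg_eq (f := mu \o tens_map f (eta \o eps))
  (g := f \o contract_r X eps)) => p.
rewrite -[LHS]/(mu (tens_map f (eta \o eps) << p >>)) -[RHS]/(f (contract_r X eps << p >>)).
by rewrite tens_mapU [contract_r _ _ _]linextU mu1 linearZ.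
Qed.

Lemma convDl (f f' g : {linear H -> H}) d : conv (f \+ f') g d = conv f g d + conv f' g d.
Proof. by rewrite !convE tens_mapDl linearD. Qed.

Lemma convBl (f f' g : {linear H -> H}) d : conv (f \- f') g d = conv f g d - conv f' g d.
Proof.
apply/eqP; rewrite eq_sym subr_eq -convDl; apply/eqP/eq_conv => // x.
by rewrite /= subrK.
Qed.

Lemma convDr (f g g' : {linear H -> H}) d : conv f (g \+ g') d = conv f g d + conv f g' d.
Proof. by rewrite !convE tens_mapDr linearD. Qed.

Lemma convBr (f g g' : {linear H -> H}) d : conv f (g \- g') d = conv f g d - conv f g' d.
Proof.
apply/eqP; rewrite eq_sym subr_eq -convDr; apply/eqP/eq_conv => // x.
by rewrite /= subrK.
Qed.

Variable f : {linear H -> H}.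

(** Recursive form of the powers, with the convolution unit as zeroth power; [convpowE] identifies
    it with the iterated form for positive exponents. *)
Fixpoint cpow (k : nat) : {linear H -> H} :=
  if k is k'.+1 then conv f (cpow k') else eta \o eps.

Lemma cpow1 : cpow 1 =1 f.
Proof. exact: convf1. Qed.

(** [f] commutes with its own powers by associativity; the left inverse identity needs the factor on
    the right. *)
Lemma cpowSr k : cpow k.+1 =1 conv (cpow k) f.
Proof.
elim: k => [|k IHk] d; first by rewrite cpow1 conv1f.
rewrite [LHS](eq_conv (f' := f) (g' := conv (cpow k) f)) // -convA.
by apply: eq_conv.
Qed.

Lemma convpowE k d : convpow mu Delta f k.+1 d = cpow k.+1 d.
Proof.
elim: k d => [|k IHk] d; first by rewrite cpow1.
rewrite [RHS](eq_conv (f' := f) (g' := convpow mu Delta f k.+1)) //.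
rewrite convE /convpow /=; congr (mu _).
rewrite (@tens_map_comp K _ _ _ _ _ _ f (tpow_map f k) idfun (iter_comul Delta k)
  f (tpow_map f k \o iter_comul Delta k)) //.
exact: (@tens_map_comp K _ _ _ _ _ _ idfun (iter_mul mu k) f
  (tpow_map f k \o iter_comul Delta k) f (convpow mu Delta f k.+1)).
Qed.

End Convolution.

(** * The geometric series inverting the identity *)

Section Antipode.
Variables (K : fieldType) (X : choiceType).
Local Notation H := {freeg X / K}.
Variables (mu : {linear {freeg (X * X)%type / K} -> H}) (eta : {linear K^o -> H}).
Variables (Delta : {linear H -> {freeg (X * X)%type / K}}) (eps : {linear H -> K^o}).
Hypothesis alg : is_algebra mu eta.
Hypothesis coalg : is_coalgebra Delta eps.

Let u : {linear H -> H} := (eta \o eps) \- idfun.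
Let upow k := cpow mu eta Delta eps u k.

Variable nc : X -> nat.
Hypothesis upow_nil : forall x k, (nc x < k)%N -> upow k << x >> = 0.

(** The series of powers of e - Id, cut on each basis vector at the bound [nc x] beyond which all
    powers vanish. *)
Definition antipode_series : {linear H -> H} :=
  linext (fun x => \sum_(0 <= k < (nc x).+1) upow k << x >>).

Lemma antipode_seriesU x N : (nc x <= N)%N ->
  antipode_series << x >> = \sum_(0 <= k < N.+1) upow k << x >>.
Proof.
move=> lexN; rewrite /= linextU [RHS](@big_cat_nat _ _ _ (nc x).+1) //=.
rewrite [X in _ + X]big_nat_cond [X in _ + X]big1 ?addr0 // => k.
by rewrite andbT => /andP[+ _]; apply: upow_nil.
Qed.

(** Here the cut is the same for all basis vectors, so this is a convolution polynomial in [u], to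
    which telescoping applies. *)
Let psum N : {linear H -> H} := linext (fun x => \sum_(0 <= k < N.+1) upow k << x >>).

Let psumE N d : psum N d = \sum_(0 <= k < N.+1) upow k d.
Proof.
apply: (eq_on_basis (f := psum N) (g := fun d => \sum_(0 <= k < N.+1) upow k d)).
- exact: linearP.
- move=> c d1 d2; rewrite scaler_sumr -big_split; apply: eq_bigr => k _.
  exact: linearP.
by move=> x; rewrite /= linextU.
Qed.

Let psumS N d : psum N.+1 d = psum N d + upow N.+1 d.
Proof. by rewrite !psumE big_nat_recr. Qed.

Let idE d : d = ((eta \o eps) \- u) d.
Proof. by rewrite /= opprB addrC subrK. Qed.

(** Since Id = e - u and e is the convolution unit, (e + u + ... + u^N) * (e - u) telescopes to e -
    u^(N+1). *)
Let conv_psum_l N d : conv mu Delta (psum N) idfun d = eta (eps d) - upow N.+1 d.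
Proof.
rewrite (@eq_conv _ _ mu Delta (psum N) (psum N) idfun ((eta \o eps) \- u) (fun=> erefl) idE).
elim: N => [|N IHN].
  rewrite (eq_conv _ _ (f' := eta \o eps) (g' := (eta \o eps) \- u)) // => [|x].
    by rewrite conv1f // [in RHS]/upow cpow1.
  by rewrite psumE big_nat1.
rewrite (@eq_conv _ _ _ _ (psum N.+1) (psum N \+ upow N.+1)
  ((eta \o eps) \- u) ((eta \o eps) \- u) (psumS N) (fun=> erefl)) convDl IHN.
rewrite (convBr mu Delta (upow N.+1) (eta \o eps) u) (convf1 alg coalg (upow N.+1)).
by rewrite -(cpowSr alg coalg u N.+1 d) addrA subrK.
Qed.

Let conv_psum_r N d : conv mu Delta idfun (psum N) d = eta (eps d) - upow N.+1 d.
Proof.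
rewrite (@eq_conv _ _ mu Delta idfun ((eta \o eps) \- u) (psum N) (psum N) idE (fun=> erefl)).
elim: N => [|N IHN].
  rewrite (eq_conv _ _ (f' := (eta \o eps) \- u) (g' := eta \o eps)) // => [|x].
    by rewrite convf1 // [in RHS]/upow cpow1.
  by rewrite psumE big_nat1.
rewrite (@eq_conv _ _ _ _ ((eta \o eps) \- u) ((eta \o eps) \- u)
  (psum N.+1) (psum N \+ upow N.+1) (fun=> erefl) (psumS N)) convDr IHN.
rewrite (convBl mu Delta (eta \o eps) u (upow N.+1)) conv1f //.
by rewrite addrA subrK.
Qed.

(* Delta <<x>> has finite support, so in the two identities at <<x>> the series
   can be truncated at one bound for all the terms involved. *)
Lemma antipode_seriesP : is_antipode mu eta Delta eps antipode_series.
Proof.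
(* The first entry makes the remainder power vanish on [<< x >>]; the second makes the series agree
   with its truncation on both legs of the coproduct. *)
pose bound x := maxn (nc x) (\max_(p <- dom (Delta << x >>)) maxn (nc p.1) (nc p.2)).
have seriesE x y : (nc y <= bound x)%N -> antipode_series << y >> = psum (bound x) << y >>.
  by move=> le; rewrite (antipode_seriesU le) psumE.
have legs x p : p \in dom (Delta << x >>) -> (maxn (nc p.1) (nc p.2) <= bound x)%N.
  move=> px; rewrite leq_max; apply/orP; right.
  exact: (@leq_bigmax_seq _ _ xpredT (fun p => maxn (nc p.1) (nc p.2))).
have nil x : upow (bound x).+1 << x >> = 0 by apply: upow_nil; rewrite ltnS leq_maxl.
split.
- apply: (linear_freeg_eq (f := conv mu Delta antipode_series idfun) (g := eta \o eps)) => x.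
  rewrite [RHS]/= -[RHS]subr0 -(nil x) -conv_psum_l !convE; congr (mu _).
  rewrite [LHS]linextE [RHS]linextE; apply: eq_big_seq => p /legs; rewrite geq_max => /andP[le _].
  by congr (_ *: tens _ _); apply: seriesE.
- apply: (linear_freeg_eq (f := conv mu Delta idfun antipode_series) (g := eta \o eps)) => x.
  rewrite [RHS]/= -[RHS]subr0 -(nil x) -conv_psum_r !convE; congr (mu _).
  rewrite [LHS]linextE [RHS]linextE; apply: eq_big_seq => p /legs; rewrite geq_max => /andP[_ le].
  by congr (_ *: tens _ _); apply: seriesE.
Qed.

End Antipode.

(** * The product *)

Section Product.
Variable K : fieldType.
Local Notation F X := {freeg X%type / K}.

(** Extended by 0 to diagrams that are not rule diagrams, which turns sums over valid matches into
    sums over all of [gmatch]. *)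
Definition basis (d : diagram) : F dclass :=
  if pselect (is_rule_diagram d) is left p then delta K (RuleDiagram p) else 0.

Lemma basisE (d : rule_diagram) : basis d = << class_of d >>.
Proof.
rewrite /basis /delta; case: pselect => [p|]; last by case; exact: rd_prop.
by congr << _ >>; apply/class_ofP/diagram_iso_refl.
Qed.

Lemma basis0 d : ~ is_rule_diagram d -> basis d = 0.
Proof. by rewrite /basis; case: pselect. Qed.

Lemma basis_iso d d' : diagram_iso d d' -> basis d = basis d'.
Proof.
move=> dd'; rewrite /basis /delta; case: pselect => p; case: pselect => p' //.
- by congr << _ >>; apply/class_ofP.
- by case: p'; apply: is_rule_diagram_iso p.
- by case: p; apply: is_rule_diagram_iso p'; apply: diagram_iso_sym.
Qed.

Lemma basis_rep x : basis (rep x) = << x >>.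
Proof. by rewrite basisE repK. Qed.

Lemma basis_diagram0 : basis diagram0 = << class0 >>.
Proof. exact: (basisE (RuleDiagram diagram0_rule_diagram)). Qed.

Lemma sum_mcompose_iso A A' B B' (M : nmodType) (f : diagram -> M) :
  (forall d d', diagram_iso d d' -> f d = f d') ->
  diagram_iso A A' -> diagram_iso B B' ->
  \sum_(m : gmatch A B) f (mcompose m) = \sum_(m : gmatch A' B') f (mcompose m).
Proof.
move=> f_iso [iV [iE [oV [oE i]]]] [jV [jE [pV [pE j]]]].
have [[[iVb iEb _ _] _ _ _] _ _] := i; have [[_ [pVb pEb _ _] _ _] _ _] := j.
rewrite (reindex (fun m : gmatch A' B' => (pull_rel pV iV m.1, pull_rel pE iE m.2))).
  by apply: eq_bigr => m _; apply: f_iso; do 4!eexists; exact: compose_isom i j.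
apply: onW_bij; have [g gK g'K] := pull_rel_bij pVb iVb.
have [h hK h'K] := pull_rel_bij pEb iEb.
by exists (fun m => (g m.1, h m.2)) => -[x y] /=; rewrite ?(gK, hK, g'K, h'K).
Qed.

(** Frees the product from the representatives chosen by [rep]: the sum over all relations is
    invariant under isomorphism, and relations outside [is_match] contribute 0. *)
Lemma rd_muE (A B : diagram) : is_rule_diagram A -> is_rule_diagram B ->
  rd_mu K (tens (basis A) (basis B)) = \sum_(m : gmatch A B) basis (mcompose m).
Proof.
move=> rA rB; rewrite (basisE (RuleDiagram rA)) (basisE (RuleDiagram rB)) tensU [LHS]linextU.
pose A' := rep (class_of (RuleDiagram rA)); pose B' := rep (class_of (RuleDiagram rB)).
transitivity (\sum_(m : {m | @is_match A' B' m}) basis (rd_compose m)).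
  by apply: eq_bigr => m _; rewrite basisE.
rewrite -(@sum_mcompose_iso A' A B' B _ basis basis_iso (rep_class_of _) (rep_class_of _)).
rewrite (bigID (fun m : gmatch A' B' => is_match m)) /= [X in _ + X]big1 ?addr0.
  rewrite [RHS](big_sub (fun m : gmatch A' B' => is_match m)).
  by [].
by move=> m mN; apply: basis0; move/asboolP: mN.
Qed.

Lemma coherent_mcompose A B (m : gmatch A B) : is_rule_diagram (mcompose m) ->
  coherent A /\ coherent B.
Proof.
by move=> /rule_diagram_coherent W; split;
  [apply: coherent_compose_l W | apply: coherent_compose_r W].
Qed.

(** If the inner composite is not a rule diagram, no composite containing it is: coherence would
    descend to it and suffice to make it one. Both sides are then 0. *)
Lemma rd_mu_l (A B C : diagram) (m : gmatch A B) :
  is_rule_diagram A -> is_rule_diagram B -> is_rule_diagram C ->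
  rd_mu K (tens (basis (mcompose m)) (basis C)) =
  \sum_(m' : gmatch (mcompose m) C) basis (mcompose m').
Proof.
move=> rA rB rC; have [rm|nrm] := pselect (is_rule_diagram (mcompose m)); first exact: rd_muE.
rewrite (basis0 nrm) tens0l raddf0 big1 // => m' _; apply: basis0.
by move=> /coherent_mcompose[/(compose_rule_diagram rA rB)].
Qed.

Lemma rd_mu_r (A B C : diagram) (m : gmatch B C) :
  is_rule_diagram A -> is_rule_diagram B -> is_rule_diagram C ->
  rd_mu K (tens (basis A) (basis (mcompose m))) =
  \sum_(m' : gmatch A (mcompose m)) basis (mcompose m').
Proof.
move=> rA rB rC; have [rm|nrm] := pselect (is_rule_diagram (mcompose m)); first exact: rd_muE.
rewrite (basis0 nrm) tens0r raddf0 big1 // => m' _; apply: basis0.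
by move=> /coherent_mcompose[_ /(compose_rule_diagram rB rC)].
Qed.

(** Both sides unfold to sums over triples of pairwise matches, compared term by term through
    [mcomposeA]. *)
Lemma rd_muA_basis (A B C : diagram) :
  is_rule_diagram A -> is_rule_diagram B -> is_rule_diagram C ->
  rd_mu K (tens (rd_mu K (tens (basis A) (basis B))) (basis C)) =
  rd_mu K (tens (basis A) (rd_mu K (tens (basis B) (basis C)))).
Proof.
move=> rA rB rC; rewrite (rd_muE rA rB) (rd_muE rB rC) tens_suml tens_sumr !linear_sum.
under eq_bigr do rewrite rd_mu_l //.
under [RHS]eq_bigr do rewrite rd_mu_r //.
under eq_bigr => m _ do rewrite (reindex _ (onW_bij _ (@row_match_bij A B C m))).
under [RHS]eq_bigr => m _ do rewrite (reindex _ (onW_bij _ (@col_match_bij A B C m))).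
rewrite !pair_bigA /=.
rewrite (reindex (fun q : gmatch B C * (gmatch A B * gmatch A C) => (q.2.1, (q.2.2, q.1)))) /=.
  by apply: eq_bigr => -[m1 [m2 m3]] _; apply/esym/basis_iso/mcomposeA.
apply: onW_bij; exists (fun q : gmatch A B * (gmatch A C * gmatch B C) => (q.2.2, (q.1, q.2.1))).
  by move=> [? []].
by move=> [? []].
Qed.

Lemma rd_muA w : rd_mu K (tens_map (rd_mu K) idfun w) =
  rd_mu K (tens_map idfun (rd_mu K) (tens_assoc K dclass dclass dclass w)).
Proof.
move: w; apply: (linear_freeg_eq (f := rd_mu K \o tens_map (rd_mu K) idfun)
  (g := rd_mu K \o tens_map idfun (rd_mu K) \o tens_assoc K dclass dclass dclass)) => -[[x y] z].
rewrite -[LHS]/(rd_mu K (tens_map (rd_mu K) idfun << (x, y, z) >>)).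
rewrite -[RHS]/(rd_mu K (tens_map idfun (rd_mu K) (tens_assoc K _ _ _ << (x, y, z) >>))).
rewrite -!tensU tens_assocE !tens_mapE -!basis_rep.
exact: rd_muA_basis (rd_prop _) (rd_prop _) (rd_prop _).
Qed.

Lemma sum_gmatch_void A B (f : gmatch A B -> F dclass) :
  (forall m m' : gmatch A B, m = m') -> \sum_m f m = f (set0, set0).
Proof. by move=> eqm; rewrite (bigD1 (set0, set0)) //= big1 ?addr0 // => m /eqP[]. Qed.

Lemma rd_mu1 d : rd_mu K (tens << class0 >> d) = d.
Proof.
apply: (eq_on_basis (f := fun d => rd_mu K (tens << class0 >> d)) (g := fun d => d)) => //.
  by move=> c u v; rewrite tens_linear_r linearP.
move=> x; rewrite -basis_diagram0 -basis_rep.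
rewrite rd_muE; try by [exact: diagram0_rule_diagram | exact: rd_prop].
rewrite sum_gmatch_void; last first.
  by move=> [X Y] [X' Y']; congr (_, _); apply/setP=> -[? []].
apply: basis_iso; exact/diagram_iso_sym/diagram_sum0.
Qed.

Lemma rd_mul1 d : rd_mu K (tens d << class0 >>) = d.
Proof.
apply: (eq_on_basis (f := fun d => rd_mu K (tens d << class0 >>)) (g := fun d => d)) => //.
  by move=> c u v; rewrite tens_linear_l linearP.
move=> x; rewrite -basis_diagram0 -basis_rep.
rewrite rd_muE; try by [exact: diagram0_rule_diagram | exact: rd_prop].
rewrite sum_gmatch_void; last first.
  by move=> [X Y] [X' Y']; congr (_, _); apply/setP=> -[[] ?].
apply: basis_iso.
apply: diagram_iso_trans (diagram_sumC _ _) _.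
exact/diagram_iso_sym/diagram_sum0.
Qed.

Lemma rd_algebra : is_algebra (rd_mu K) (rd_eta K).
Proof.
split; first exact: rd_muA.
- by move=> k d; rewrite -[rd_eta K k]/(k *: << class0 >>) tensZl linearZ /= rd_mu1.
- by move=> k d; rewrite -[rd_eta K k]/(k *: << class0 >>) tensZr linearZ /= rd_mul1.
Qed.

End Product.

(** * The coproduct as a sum over colourings *)

Lemma diagram_isom_sym d d' iV iE oV oE : @diagram_isom d d' iV iE oV oE ->
  exists iV' iE' oV' oE',
    [/\ @diagram_isom d' d iV' iE' oV' oE', cancel iV' iV & cancel oV' oV].
Proof.
move=> [i mV mE]; have [[iVb iEb _ _] [oVb oEb _ _] _ _] := i.
case: iVb iEb oVb oEb => [iV' ? iVK] [iE' ? iEK] [oV' ? oVK] [oE' ? oEK].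
exists iV', iE', oV', oE'; split=> //; split; first exact: rule_isom_inv i _ _ _ _ _ _ _ _.
- by move=> b a; rewrite -mV oVK iVK.
- by move=> b a; rewrite -mE oEK iEK.
Qed.

Section Coproduct.
Variable K : fieldType.
Local Notation F X := {freeg X%type / K}.
Local Notation basis := (basis K).

(** The contribution of one colouring to the coproduct; the parts are picked by [cid], harmlessly so
    by [splits_uniq]. *)
Definition split_term (d : diagram) (c : colouring d) : F (dclass * dclass) :=
  if pselect (exists D : rule_diagram * rule_diagram, splits c D.1 D.2) is left D
  then tens (basis (projT1 (cid D)).1) (basis (projT1 (cid D)).2) else 0.

Lemma split_termE d (c : colouring d) (D1 D2 : diagram) :
  splits c D1 D2 -> split_term c = tens (basis D1) (basis D2).
Proof.
move=> sp; rewrite /split_term; case: pselect => [D | nD].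
  case: cid => /= -[D1' D2'] sp'; have [i1 i2] := splits_uniq sp sp'.
  by rewrite /= (basis_iso K i1) (basis_iso K i2).
(* No decomposition into rule diagrams exists here, so one of [D1] and [D2] is not a rule diagram
   and its [basis] is 0. *)
have [r1|nr] := pselect (is_rule_diagram D1); last by rewrite (basis0 K nr) tens0l.
have [r2|nr] := pselect (is_rule_diagram D2); last by rewrite (basis0 K nr) tens0r.
by case: nD; exists (RuleDiagram r1, RuleDiagram r2).
Qed.

Lemma split_term0 d (c : colouring d) :
  (forall D1 D2 : rule_diagram, ~ splits c D1 D2) -> split_term c = 0.
Proof. by move=> nD; rewrite /split_term; case: pselect => // D; have [D0 /nD] := D. Qed.

Lemma split_term_ncut d (c : colouring d) : ~ cut c -> split_term c = 0.
Proof. by move=> nc; apply: split_term0 => D1 D2 /splits_cut. Qed.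

Lemma split_term_isom d d' iV iE oV oE (c : colouring d) (c' : colouring d') :
  @diagram_isom d d' iV iE oV oE ->
  (forall v, c'.1 (iV v) = c.1 v) -> (forall v, c'.2 (oV v) = c.2 v) ->
  split_term c' = split_term c.
Proof.
move=> i ci co.
have [[[D1 D2] /= sp]|nD] := pselect (exists D : rule_diagram * rule_diagram, splits c D.1 D.2).
  by rewrite (split_termE sp) (split_termE (splits_isom i ci co sp)).
rewrite [RHS]split_term0 => [|D1 D2 sp]; last by apply: nD; exists (D1, D2).
apply: split_term0 => D1 D2 sp; apply: nD; exists (D1, D2) => /=.
have [iV' [iE' [oV' [oE' [i' iVK oVK]]]]] := diagram_isom_sym i.
by apply: splits_isom i' _ _ sp => v; rewrite -?ci -?co ?iVK ?oVK.
Qed.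

Definition coproduct (d : diagram) : F (dclass * dclass) :=
  \sum_(c : colouring d) split_term c.

Lemma coproduct_iso d d' : diagram_iso d d' -> coproduct d = coproduct d'.
Proof.
move=> [iV [iE [oV [oE i]]]]; have [[[iVb _ _ _] [oVb _ _ _] _ _] _ _] := i.
rewrite /coproduct (reindex (fun c : colouring d' =>
  ([ffun v => c.1 (iV v)], [ffun v => c.2 (oV v)]) : colouring d)) /=.
  by apply: eq_bigr => c _; apply/esym/(split_term_isom i) => v; rewrite ffunE.
apply: onW_bij; case: iVb oVb => [iV' iVK iVK'] [oV' oVK oVK'].
exists (fun c : colouring d => ([ffun v => c.1 (iV' v)], [ffun v => c.2 (oV' v)]) : colouring d').
- by move=> [c1 c2]; congr (_, _); apply/ffunP=> v; rewrite !ffunE /= ?ffunE ?iVK' ?oVK'.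
- by move=> [c1 c2]; congr (_, _); apply/ffunP=> v; rewrite !ffunE /= ?ffunE ?iVK ?oVK.
Qed.

Lemma coproduct_join A B (m : gmatch A B) :
  coproduct (mcompose m) = \sum_(p : colouring A * colouring B) split_term (join m p).
Proof. by rewrite /coproduct (reindex _ (onW_bij _ (join_bij m))). Qed.

(** Only block-diagonal matches contribute, and such a match is an independent choice of a match for
    each colour, so the sum factors as a tensor. *)
Lemma sum_side_terms A1 A2 B1 B2 :
  \sum_(m : gmatch (diagram_sum A1 A2) (diagram_sum B1 B2))
     split_term (join m (side A1 A2, side B1 B2)) =
  tens (\sum_(m : gmatch A1 B1) basis (mcompose m)) (\sum_(m : gmatch A2 B2) basis (mcompose m)).
Proof.
rewrite tens_suml; under [RHS]eq_bigr do rewrite tens_sumr; rewrite pair_bigA /=.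
rewrite (bigID (fun m => diag_match (diag_blocks m) == m)) /= [X in _ + X]big1 ?addr0.
  rewrite (reindex_onto (@diag_match A1 A2 B1 B2) (@diag_blocks A1 A2 B1 B2)) /= => [|m /eqP //].
  apply: eq_big => [p|p _]; first by rewrite diag_matchK !eqxx.
  exact: split_termE (splits_diag_match p).
move=> m /eqP mN; apply: split_term0 => D1 D2 sp; apply: mN.
apply: cut_diag_match (splits_cut sp).
apply: is_rule_diagram_iso (splits_iso sp) _.
exact: diagram_sum_rule_diagram (rd_prop _) (rd_prop _).
Qed.

(** The sums are exchanged so that the colourings of A and B are fixed first. If one of them is not
    a cut, both sides vanish; otherwise [splits_join] reduces to [sum_side_terms]. *)
Lemma sum_coproduct_mcompose A B : is_rule_diagram A -> is_rule_diagram B ->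
  \sum_(m : gmatch A B) coproduct (mcompose m) =
  tens_map (rd_mu K) (rd_mu K) (tens_swap K _ _ _ _ (tens (coproduct A) (coproduct B))).
Proof.
move=> rA rB; under eq_bigr do rewrite coproduct_join.
have -> : tens (coproduct A) (coproduct B) =
    \sum_(p : colouring A * colouring B) tens (split_term p.1) (split_term p.2).
  rewrite tens_suml -(pair_bigA _ (fun c c' => tens (split_term c) (split_term c'))) /=.
  by apply: eq_bigr => c _; rewrite tens_sumr.
rewrite exchange_big !linear_sum; apply: eq_bigr => -[c c'] _.
have [cc|nc] := pselect (cut c); last first.
  rewrite (split_term_ncut nc) tens0l !raddf0 big1 // => m _.
  by apply: split_term_ncut => /cut_join[].
have [cc'|nc'] := pselect (cut c'); last first.
  rewrite (split_term_ncut nc') tens0r !raddf0 big1 // => m _.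
  by apply: split_term_ncut => /cut_join[].
have [A1 [A2 spA]] := cut_splits rA cc; have [B1 [B2 spB]] := cut_splits rB cc'.
rewrite (split_termE spA) (split_termE spB).
have [f f_bij [_ fP]] := splits_join spA spB.
transitivity (\sum_(m : gmatch (diagram_sum A1 A2) (diagram_sum B1 B2))
                split_term (join m (side A1 A2, side B1 B2))).
  rewrite [RHS](reindex f (onW_bij _ f_bij)).
  apply: eq_bigr => m _; have [iV [iE [oV [oE [i ci co]]]]] := fP m.
  exact: split_term_isom i ci co.
rewrite sum_side_terms -!rd_muE; try exact: rd_prop.
rewrite !basisE !tensU [tens_swap _ _ _ _ _ _]linextU /= -!tensU.
by rewrite tens_mapE.
Qed.

End Coproduct.

(** * Adding a primitive component *)

Definition full (d : diagram) (b : bool) : colouring d := ([ffun=> b], [ffun=> b]).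

Lemma splits_full_true d : splits (full d true) d diagram0.
Proof.
have i : diagram_iso (diagram_sum d diagram0) d.
  apply: diagram_iso_trans (diagram_sumC _ _) _.
  exact/diagram_iso_sym/diagram_sum0.
have [iV [iE [oV [oE i']]]] := i.
by exists iV, iE, oV, oE; split=> // -[v|[]]; rewrite ffunE.
Qed.

Lemma splits_full_false d : splits (full d false) diagram0 d.
Proof.
have [iV [iE [oV [oE i]]]] := diagram_iso_sym (diagram_sum0 d).
by exists iV, iE, oV, oE; split=> // -[[]|v]; rewrite ffunE.
Qed.

Lemma diagram_iso0_void d : diagram_iso d diagram0 ->
  (vertex (input d) -> False) /\ (vertex (output d) -> False).
Proof. by move=> [iV [_ [oV _]]]; split=> [/iV|/oV] []. Qed.

(** Primitivity forces one of the two parts to be empty, so every vertex has the colour of the other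
    part. *)
Lemma splits_primitive (d : rule_diagram) (c : colouring d) (D1 D2 : rule_diagram) :
  primitive (class_of d) -> splits c D1 D2 -> c = full d true \/ c = full d false.
Proof.
move=> [_ prim] sp; have [iV [iE [oV [oE [[[[iVb _ _ _] [oVb _ _ _] _ _] _ _] ci co]]]]] := sp.
have [iV' _ iVK] := iVb; have [oV' _ oVK] := oVb.
have [/class_ofP/diagram_iso0_void[D1i D1o]|D1N] :=
  pselect (class_of D1 = class_of (RuleDiagram diagram0_rule_diagram)).
  right; case: c ci co {sp} => ci' co' /= ci co; congr (_, _); apply/ffunP=> v; rewrite ffunE.
  - by rewrite -(iVK v) ci; case: (iV' v) => [w|w] //; case: (D1i w).
  - by rewrite -(oVK v) co; case: (oV' v) => [w|w] //; case: (D1o w).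
have [/class_ofP/diagram_iso0_void[D2i D2o]|D2N] :=
  pselect (class_of D2 = class_of (RuleDiagram diagram0_rule_diagram)).
  left; case: c ci co {sp} => ci' co' /= ci co; congr (_, _); apply/ffunP=> v; rewrite ffunE.
  - by rewrite -(iVK v) ci; case: (iV' v) => [w|w] //; case: (D2i w).
  - by rewrite -(oVK v) co; case: (oV' v) => [w|w] //; case: (D2o w).
case: prim; exists (class_of D1), (class_of D2); split=> //.
apply/class_ofP => /=; apply: diagram_iso_trans (diagram_iso_sym (splits_iso sp)) _.
by apply: diagram_sum_congr; apply: diagram_iso_sym; apply: rep_class_of.
Qed.

Section Hopf.
Variable K : fieldType.
Local Notation F X := {freeg X%type / K}.
Local Notation basis := (basis K).

Lemma basis_sum (D1 D2 : rule_diagram) :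
  basis (diagram_sum D1 D2) = << class_sum (class_of D1) (class_of D2) >>.
Proof.
rewrite (basisE K (RuleDiagram (diagram_sum_rule_diagram (rd_prop D1) (rd_prop D2)))).
congr << _ >>; apply/class_ofP => /=.
by apply: diagram_sum_congr; apply: diagram_iso_sym; apply: rep_class_of.
Qed.

Lemma split_term_sum Y X (c : colouring Y) (c' : colouring X) Y1 Y2 X1 X2 :
  splits c Y1 Y2 -> splits c' X1 X2 ->
  split_term K (join ((set0, set0) : gmatch Y X) (c, c')) =
  tens (basis (diagram_sum Y1 X1)) (basis (diagram_sum Y2 X2)).
Proof.
move=> spY spX; have [f _ [f0 fP]] := splits_join spY spX.
have [iV [iE [oV [oE [i ci co]]]]] := fP (set0, set0).
rewrite (split_term_isom K i ci co) f0.
have -> : (set0, set0) = @diag_match Y1 Y2 X1 X2 ((set0, set0), (set0, set0)).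
  by congr (_, _); apply/setP=> -[[b|b] [a|a]]; rewrite !inE.
exact: split_termE (splits_diag_match _).
Qed.

(** Applied to either leg of a tensor, these maps express multiplication by y (x) 1 + 1 (x) y for
    the product given by disjoint union. *)
Definition add_class (y : dclass) : {linear F dclass -> F dclass} :=
  linext (fun x => << class_sum y x >>).

Lemma add_classU y x : add_class y << x >> = << class_sum y x >>.
Proof. exact: linextU. Qed.

Lemma coproduct_add_primitive (Y X : rule_diagram) : primitive (class_of Y) ->
  coproduct K (diagram_sum Y X) =
  tens_map (add_class (class_of Y)) idfun (coproduct K X) +
  tens_map idfun (add_class (class_of Y)) (coproduct K X).
Proof.
move=> prim; set y := class_of Y; set TL := tens_map _ idfun; set TR := tens_map idfun _.
rewrite -[diagram_sum Y X]/(mcompose ((set0, set0) : gmatch Y X)) coproduct_join.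
rewrite -(pair_bigA _ (fun c c' => split_term K (join ((set0, set0) : gmatch Y X) (c, c')))) /=.
(* A non-empty diagram has a vertex, so the two constant colourings are distinct and give two
   separate terms. *)
have full_neq : full Y true != full Y false.
  apply/eqP=> -[/ffunP eqi /ffunP eqo]; have [y0 _] := prim.
  apply: y0; apply/class_ofP => /=; apply/diagram_iso_sym/diagram_iso0.
  have empty (G : graph) : (vertex G -> False) -> graph_empty G.
    move=> G0; apply/andP; split; apply/eqP/eq_card0 => v; exfalso; first exact: G0 v.
    exact: G0 (source v).
  by apply/andP; split; apply: empty => v; [have := eqi v | have := eqo v]; rewrite !ffunE.
rewrite (bigD1 (full Y true)) //= (bigD1 (full Y false)) 1?eq_sym //=.
rewrite [X in _ + (_ + X)]big1 ?addr0 => [|c /andP[/eqP cT /eqP cF]].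
  rewrite !linear_sum; congr (_ + _); apply: eq_bigr => c _.
  - have [cc|nc] := pselect (cut c); last first.
      by rewrite (split_term_ncut K nc) raddf0 split_term_ncut // => /cut_join[].
    have [X1 [X2 spX]] := cut_splits (rd_prop X) cc.
    rewrite (split_term_sum (splits_full_true Y) spX) (split_termE K spX) -[RHS]/(TL _) tens_mapE.
    rewrite basis_sum !basisE add_classU; congr tens.
    by rewrite -basisE; apply/basis_iso/diagram_iso_sym/diagram_sum0.
  - have [cc|nc] := pselect (cut c); last first.
      by rewrite (split_term_ncut K nc) raddf0 split_term_ncut // => /cut_join[].
    have [X1 [X2 spX]] := cut_splits (rd_prop X) cc.
    rewrite (split_term_sum (splits_full_false Y) spX) (split_termE K spX) -[RHS]/(TR _) tens_mapE.
    rewrite [basis (diagram_sum Y X2)]basis_sum !basisE add_classU; congr tens.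
    by rewrite -basisE; apply/basis_iso/diagram_iso_sym/diagram_sum0.
apply: big1 => c' _; apply: split_term_ncut => /cut_join[/= cc _].
have [Y1 [Y2 spY]] := cut_splits (rd_prop Y) cc.
by case: (splits_primitive prim spY).
Qed.

(** * The coproduct along a list of primitives *)

Definition subset_sum (s : seq dclass) (J : {set 'I_(size s)}) : dclass :=
  \big[class_sum/class0]_(i in J) nth class0 s i.

(** The formula defining [rd_Delta], with the chosen list of components replaced by an arbitrary
    list so that induction on it is possible. *)
Definition coproduct_seq (s : seq dclass) : F (dclass * dclass) :=
  \sum_(J : {set 'I_(size s)}) tens << subset_sum J >> << subset_sum (~: J) >>.

Definition cons_set n (p : bool * {set 'I_n}) : {set 'I_n.+1} :=
  [set i | if unlift ord0 i is Some j then j \in p.2 else p.1].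

Lemma cons_set_bij n : bijective (@cons_set n).
Proof.
exists (fun J : {set 'I_n.+1} => (ord0 \in J, [set j | fintype.lift ord0 j \in J])).
- by move=> [b J]; congr (_, _); [|apply/setP=> j]; rewrite !inE ?unlift_none ?fintype.liftK.
- move=> J; apply/setP=> i; rewrite inE /=.
  by case: (unliftP ord0 i) => [j|] ->; rewrite ?inE.
Qed.

Lemma subset_sum_cons y s b (J : {set 'I_(size s)}) :
  @subset_sum (y :: s) (cons_set (b, J)) =
  if b then class_sum y (subset_sum J) else subset_sum J.
Proof.
rewrite /subset_sum big_mkcond big_ord_recl inE unlift_none /=.
under eq_bigr => i _ do rewrite inE fintype.liftK.
by rewrite -big_mkcond; case: b; rewrite // class_sum0.
Qed.

Lemma setC_cons_set n b (J : {set 'I_n}) : ~: cons_set (b, J) = cons_set (~~ b, ~: J).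
Proof. by apply/setP=> i; rewrite !inE; case: unlift => [j|]; rewrite ?inE. Qed.

(** A subset of the indices of [y :: s] is a subset for [s] together with the side on which [y]
    falls; this is the recursion that the sum over colourings satisfies. *)
Lemma coproduct_seq_cons y s :
  coproduct_seq (y :: s) =
  tens_map (add_class y) idfun (coproduct_seq s) + tens_map idfun (add_class y) (coproduct_seq s).
Proof.
set TL := tens_map _ idfun; set TR := tens_map idfun _.
rewrite /coproduct_seq (reindex _ (onW_bij _ (@cons_set_bij (size s)))) /=.
rewrite -(pair_bigA _ (fun b J => tens << @subset_sum (y :: s) (cons_set (b, J)) >>
  << @subset_sum (y :: s) (~: cons_set (b, J)) >>)) /=.
rewrite big_bool !linear_sum; congr (_ + _); apply: eq_bigr => J _.
- by rewrite setC_cons_set !subset_sum_cons -[RHS]/(TL _) tens_mapE add_classU.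
- by rewrite setC_cons_set !subset_sum_cons -[RHS]/(TR _) tens_mapE add_classU.
Qed.

Lemma coproduct_rep_sum y x : primitive y ->
  coproduct K (rep (class_sum y x)) =
  tens_map (add_class y) idfun (coproduct K (rep x)) +
  tens_map idfun (add_class y) (coproduct K (rep x)).
Proof.
move=> prim; rewrite (coproduct_iso K (rep_class_of _)).
rewrite -[LHS]/(coproduct K (diagram_sum (rep y) (rep x))).
by rewrite coproduct_add_primitive repK.
Qed.

Lemma coproduct_rep_bigsum s : (forall y, y \in s -> primitive y) ->
  coproduct K (rep (\big[class_sum/class0]_(y <- s) y)) = coproduct_seq s.
Proof.
elim: s => [_|y s IHs prim]; last first.
  rewrite big_cons coproduct_rep_sum ?coproduct_seq_cons ?IHs //.
    by move=> z zs; apply: prim; rewrite inE zs orbT.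
  by apply: prim; rewrite inE eqxx.
rewrite big_nil (coproduct_iso K (rep_class_of _)) /= /coproduct /coproduct_seq.
rewrite (bigD1 (full diagram0 true)) //= big1 ?addr0; last first.
  by move=> [c1 c2] /eqP[]; congr (_, _); apply/ffunP=> -[].
rewrite (bigD1 set0) //= big1 ?addr0; last first.
  by move=> J /eqP[]; apply/setP=> -[].
rewrite (split_termE K (splits_full_true diagram0)) basis_diagram0.
by rewrite /subset_sum !big1 // => -[].
Qed.

Lemma rd_Delta_coproduct x : rd_Delta K << x >> = coproduct K (rep x).
Proof.
rewrite [LHS]linextU; have [prim xE] := projT2 (cid (decomposition_exists x)).
by rewrite [in RHS]xE coproduct_rep_bigsum.
Qed.

Lemma rd_Delta_seq s : (forall y, y \in s -> primitive y) ->
  rd_Delta K << \big[class_sum/class0]_(y <- s) y >> = coproduct_seq s.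
Proof. by move=> prim; rewrite rd_Delta_coproduct coproduct_rep_bigsum. Qed.

Lemma rd_Delta_add y : primitive y -> forall d,
  rd_Delta K (add_class y d) =
  tens_map (add_class y) idfun (rd_Delta K d) + tens_map idfun (add_class y) (rd_Delta K d).
Proof.
move=> prim; apply: (linear_freeg_eq (f := rd_Delta K \o add_class y)
  (g := (tens_map (add_class y) idfun \o rd_Delta K) \+
        (tens_map idfun (add_class y) \o rd_Delta K))) => x.
rewrite -[LHS]/(rd_Delta K (add_class y << x >>)).
rewrite -[RHS]/(tens_map (add_class y) idfun (rd_Delta K << x >>) +
  tens_map idfun (add_class y) (rd_Delta K << x >>)).
by rewrite add_classU !rd_Delta_coproduct coproduct_rep_sum.
Qed.

Lemma rd_Delta0 : rd_Delta K << class0 >> = << (class0, class0) >>.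
Proof.
have prim : forall y, y \in [::] -> primitive y by [].
have := rd_Delta_seq prim.
rewrite big_nil => ->; rewrite /coproduct_seq (bigD1 set0) //= big1 ?addr0; last first.
  by move=> J /eqP[]; apply/setP=> -[].
by rewrite tensU /subset_sum !big1 // => -[].
Qed.

(** Together with [rd_Delta_add] this proves the coalgebra axioms by adding one primitive component
    at a time. *)
Lemma primitive_ind (P : F dclass -> Prop) :
  P << class0 >> ->
  (forall y x, primitive y -> P << x >> -> P (add_class y << x >>)) ->
  forall x, P << x >>.
Proof.
move=> P0 PS x; have [s [prim ->]] := decomposition_exists x.
elim: s prim => [_|y s IHs prim]; first by rewrite big_nil.
rewrite big_cons -add_classU; apply: PS.
  by apply: prim; rewrite inE eqxx.
by apply: IHs => z zs; apply: prim; rewrite inE zs orbT.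
Qed.

Lemma rd_epsU x : rd_eps K << x >> = (x == class0)%:R.
Proof. exact: linextU. Qed.

(** The number of vertices is additive and positive away from the empty class. *)
Lemma class_sum_eq0 y x : y <> class0 -> class_sum y x != class0.
Proof.
move=> /order_of_gt0 y0; apply/eqP => /(congr1 (fun z => order_of (rep z))).
rewrite order_of_class_sum (order_of_iso (rep_class_of _)) /order_of /= !card_void.
by move/eqP; rewrite addn_eq0 eqn0Ngt y0.
Qed.

End Hopf.

(** * The Hopf algebra of rule diagrams *)

Section Bialgebra.
Variable K : fieldType.
Local Notation F X := {freeg X%type / K}.
Local Notation basis := (basis K).

(** With [L] the addition of [y], both sides at [L d] are the sum of L (x) 1 (x) 1, 1 (x) L (x) 1
    and 1 (x) 1 (x) L, applied to the two sides at [d]. *)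
Lemma rd_coassoc d :
  tens_assoc K dclass dclass dclass (tens_map (rd_Delta K) idfun (rd_Delta K d)) =
  tens_map idfun (rd_Delta K) (rd_Delta K d).
Proof.
move: d; apply: (linear_freeg_eq
  (f := tens_assoc K dclass dclass dclass \o tens_map (rd_Delta K) idfun \o rd_Delta K)
  (g := tens_map idfun (rd_Delta K) \o rd_Delta K)).
pose P d := tens_assoc K dclass dclass dclass (tens_map (rd_Delta K) idfun (rd_Delta K d)) =
  tens_map idfun (rd_Delta K) (rd_Delta K d).
apply: (primitive_ind (P := P)) => [|y x prim]; rewrite /P.
  by rewrite rd_Delta0 !tens_mapU /= rd_Delta0 -!tensU tens_assocE.
move: << x >> => {}d IHd; set L := add_class K y; rewrite rd_Delta_add // -/L !linearD.
move: (rd_Delta K d) IHd => w IHw.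
have comp (X Y X' Y' X'' Y'' : choiceType) (f : {linear F X' -> F X''})
    (g : {linear F Y' -> F Y''}) (f' : {linear F X -> F X'}) (g' : {linear F Y -> F Y'}) v :
    tens_map f g (tens_map f' g' v) = tens_map (f \o f') (g \o g') v.
  exact: tens_map_comp.
have LD : rd_Delta K \o L =1 (tens_map L idfun \o rd_Delta K) \+ (tens_map idfun L \o rd_Delta K).
  exact: rd_Delta_add.
have E1 : tens_map (rd_Delta K) idfun (tens_map L idfun w) =
    tens_map (tens_map L idfun) idfun (tens_map (rd_Delta K) idfun w) +
    tens_map (tens_map idfun L) idfun (tens_map (rd_Delta K) idfun w).
  by rewrite !comp (eq_tens_map LD (fun=> erefl)) tens_mapDl.
have E2 : tens_map (rd_Delta K) idfun (tens_map idfun L w) =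
    tens_map (tens_map idfun idfun) L (tens_map (rd_Delta K) idfun w).
  rewrite !comp; apply: eq_tens_map => // v.
  by rewrite -[RHS]/(tens_map idfun idfun (rd_Delta K v)) tens_map_id.
have E3 : tens_map idfun (rd_Delta K) (tens_map L idfun w) =
    tens_map L (tens_map idfun idfun) (tens_map idfun (rd_Delta K) w).
  rewrite !comp; apply: eq_tens_map => // v.
  by rewrite -[RHS]/(tens_map idfun idfun (rd_Delta K v)) tens_map_id.
have E4 : tens_map idfun (rd_Delta K) (tens_map idfun L w) =
    tens_map idfun (tens_map L idfun) (tens_map idfun (rd_Delta K) w) +
    tens_map idfun (tens_map idfun L) (tens_map idfun (rd_Delta K) w).
  by rewrite !comp (eq_tens_map (fun=> erefl) LD) tens_mapDr.
by rewrite E1 E2 E3 E4 !linearD !tens_assoc_map IHw addrA.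
Qed.

(** The counit kills the term with [y] in the left leg; in the other term the addition of [y]
    commutes with the contraction. *)
Lemma rd_counit_l d : contract_l dclass (rd_eps K) (rd_Delta K d) = d.
Proof.
move: d; apply: (linear_freeg_eq (f := contract_l dclass (rd_eps K) \o rd_Delta K) (g := idfun)).
pose P d := contract_l dclass (rd_eps K) (rd_Delta K d) = d.
apply: (primitive_ind (P := P)) => [|y x prim]; rewrite /P.
  by rewrite rd_Delta0 [LHS]linextU rd_epsU eqxx scale1r.
move: << x >> => {}d; rewrite rd_Delta_add // linearD; move: (rd_Delta K d) => w <-.
rewrite -[RHS]add0r; congr (_ + _).
  move: w; apply: (linear_freeg_eq
    (f := contract_l dclass (rd_eps K) \o tens_map (add_class K y) idfun) (g := \0)) => p.
  rewrite -[LHS]/(contract_l dclass (rd_eps K) (tens_map (add_class K y) idfun << p >>)).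
  rewrite tens_mapU add_classU tensU [LHS]linextU rd_epsU.
  by rewrite (negPf (class_sum_eq0 _ _)) ?scale0r //; case: prim.
move: w; apply: (linear_freeg_eq
  (f := contract_l dclass (rd_eps K) \o tens_map idfun (add_class K y))
  (g := add_class K y \o contract_l dclass (rd_eps K))) => p.
rewrite -[LHS]/(contract_l dclass (rd_eps K) (tens_map idfun (add_class K y) << p >>)).
rewrite -[RHS]/(add_class K y (contract_l dclass (rd_eps K) << p >>)).
rewrite tens_mapU add_classU tensU [LHS]linextU [contract_l _ _ _]linextU linearZ.
by rewrite add_classU.
Qed.

Lemma rd_counit_r d : contract_r dclass (rd_eps K) (rd_Delta K d) = d.
Proof.
move: d; apply: (linear_freeg_eq (f := contract_r dclass (rd_eps K) \o rd_Delta K) (g := idfun)).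
pose P d := contract_r dclass (rd_eps K) (rd_Delta K d) = d.
apply: (primitive_ind (P := P)) => [|y x prim]; rewrite /P.
  by rewrite rd_Delta0 [LHS]linextU rd_epsU eqxx scale1r.
move: << x >> => {}d; rewrite rd_Delta_add // linearD; move: (rd_Delta K d) => w <-.
rewrite -[RHS]addr0; congr (_ + _).
  move: w; apply: (linear_freeg_eq
    (f := contract_r dclass (rd_eps K) \o tens_map (add_class K y) idfun)
    (g := add_class K y \o contract_r dclass (rd_eps K))) => p.
  rewrite -[LHS]/(contract_r dclass (rd_eps K) (tens_map (add_class K y) idfun << p >>)).
  rewrite -[RHS]/(add_class K y (contract_r dclass (rd_eps K) << p >>)).
  rewrite tens_mapU add_classU tensU [LHS]linextU [contract_r _ _ _]linextU linearZ.
  by rewrite add_classU.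
move: w; apply: (linear_freeg_eq
  (f := contract_r dclass (rd_eps K) \o tens_map idfun (add_class K y)) (g := \0)) => p.
rewrite -[LHS]/(contract_r dclass (rd_eps K) (tens_map idfun (add_class K y) << p >>)).
rewrite tens_mapU add_classU tensU [LHS]linextU rd_epsU.
by rewrite (negPf (class_sum_eq0 _ _)) ?scale0r //; case: prim.
Qed.

Lemma rd_coalgebra : is_coalgebra (rd_Delta K) (rd_eps K).
Proof. by split; [exact: rd_coassoc | exact: rd_counit_l | exact: rd_counit_r]. Qed.

(** Both sides vanish when [d] is not a rule diagram, since a disjoint union of rule diagrams is
    one; hence the formula applies to every term of a product. *)
Lemma rd_Delta_basis d : rd_Delta K (basis d) = coproduct K d.
Proof.
have [rd|nrd] := pselect (is_rule_diagram d).
  rewrite (basisE K (RuleDiagram rd)) rd_Delta_coproduct.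
  exact: coproduct_iso (rep_class_of _).
rewrite basis0 // raddf0 /coproduct big1 // => c _; apply: split_term0 => D1 D2 sp.
apply: nrd; apply: is_rule_diagram_iso (splits_iso sp) _.
exact: diagram_sum_rule_diagram (rd_prop _) (rd_prop _).
Qed.

Lemma rd_Delta_mu w : rd_Delta K (rd_mu K w) =
  tens_map (rd_mu K) (rd_mu K)
    (tens_swap K dclass dclass dclass dclass (tens_map (rd_Delta K) (rd_Delta K) w)).
Proof.
move: w; apply: (linear_freeg_eq (f := rd_Delta K \o rd_mu K)
  (g := tens_map (rd_mu K) (rd_mu K) \o tens_swap K dclass dclass dclass dclass \o
        tens_map (rd_Delta K) (rd_Delta K))) => -[x y].
rewrite -[LHS]/(rd_Delta K (rd_mu K << (x, y) >>)).
rewrite -[RHS]/(tens_map (rd_mu K) (rd_mu K) (tens_swap K dclass dclass dclass dclass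
  (tens_map (rd_Delta K) (rd_Delta K) << (x, y) >>))).
rewrite -tensU tens_mapE -!basis_rep !rd_Delta_basis.
rewrite rd_muE ?linear_sum; try exact: rd_prop.
rewrite -sum_coproduct_mcompose; try exact: rd_prop.
by apply: eq_bigr => m _; apply: rd_Delta_basis.
Qed.

Lemma rd_eps_basis d : order_of d != 0%N -> rd_eps K (basis d) = 0.
Proof.
move=> d0; have [rd|nrd] := pselect (is_rule_diagram d); last by rewrite basis0 ?raddf0.
rewrite (basisE K (RuleDiagram rd)) rd_epsU; case: eqP => // /class_ofP /order_of_iso /= dE.
by move: d0; rewrite dE /order_of /= !card_void.
Qed.

(** A composite has the vertices of both factors, so with a non-empty left factor both sides are 0;
    an empty left factor is the unit. *)
Lemma rd_eps_mu d d' : rd_eps K (rd_mu K (tens d d')) = (rd_eps K d : K) * (rd_eps K d' : K).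
Proof.
apply: (eq_on_basis (M := K^o) (f := fun d => rd_eps K (rd_mu K (tens d d')))
                    (g := fun d => (rd_eps K d : K) * (rd_eps K d' : K) : K^o)).
- by move=> c u v; rewrite tens_linear_l !linearP.
- by move=> c u v; rewrite linearP mulrDl scalerAl.
move=> x; apply: (eq_on_basis (M := K^o) (f := fun d' => rd_eps K (rd_mu K (tens << x >> d')))
                    (g := fun d' => (rd_eps K << x >> : K) * (rd_eps K d' : K) : K^o)).
- by move=> c u v; rewrite tens_linear_r !linearP.
- by move=> c u v; rewrite linearP mulrDr scalerAr.
move=> y; rewrite rd_epsU; have [->|/eqP x0] := eqVneq x class0.
  by rewrite rd_mu1 mul1r.
rewrite mul0r -!basis_rep rd_muE ?linear_sum; try exact: rd_prop.
apply: big1 => m _; apply: rd_eps_basis.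
by rewrite /order_of /= !card_sum addnACA -lt0n addn_gt0 order_of_gt0.
Qed.

Lemma rd_bialgebra : is_bialgebra (rd_mu K) (rd_eta K) (rd_Delta K) (rd_eps K).
Proof.
have etaE k : rd_eta K k = k *: << class0 >> by [].
split; [exact: rd_algebra | exact: rd_coalgebra | split | split].
- exact: rd_Delta_mu.
- by move=> k; rewrite !etaE linearZ !scale1r tensU; congr (_ *: _); apply: rd_Delta0.
- exact: rd_eps_mu.
- by move=> k; rewrite etaE linearZ rd_epsU eqxx; apply: mulr1.
Qed.

(** * Vanishing of the powers of e - Id *)

Local Notation upow := (cpow (rd_mu K) (rd_eta K) (rd_Delta K) (rd_eps K) (rd_e K \- idfun)).

Lemma rd_e_sub0 : (rd_e K \- idfun : {linear F dclass -> F dclass}) << class0 >> = 0.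
Proof.
rewrite -[LHS]/(rd_eps K << class0 >> *: << class0 >> - << class0 >>).
by rewrite rd_epsU eqxx scale1r subrr.
Qed.

(** In each term of the coproduct either the left subset is empty and killed by e - Id, or its
    complement has fewer components than [s] and is killed by the next lower power. *)
Lemma upow_bigsum_eq0 k (s : seq dclass) :
  (forall y, y \in s -> primitive y) -> (size s < k)%N ->
  upow k << \big[class_sum/class0]_(y <- s) y >> = 0.
Proof.
elim: k s => // k IHk s prim; rewrite ltnS => lesk.
rewrite -[LHS]/(rd_mu K (tens_map (rd_e K \- idfun) (upow k) (rd_Delta K _))).
rewrite rd_Delta_seq // /coproduct_seq !linear_sum big1 // => J _.
rewrite -[RHS](raddf0 (rd_mu K)); congr (rd_mu K _).
rewrite -[LHS]/(tens_map (rd_e K \- idfun) (upow k) (tens _ _)) tens_mapE.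
have [->|J0] := eqVneq J set0.
  by rewrite /subset_sum big_set0 rd_e_sub0 tens0l.
have -> : subset_sum (~: J) =
    \big[class_sum/class0]_(y <- [seq nth class0 s i | i : 'I_(size s) <- enum (~: J)]) y.
  by rewrite big_map big_enum.
rewrite IHk ?tens0r //.
  by move=> y /mapP[i _ ->]; apply/prim/mem_nth.
rewrite size_map -cardE cardsCs setCK card_ord.
apply: leq_trans lesk; rewrite ltn_subrL card_gt0 J0 /=.
by have [i _] := set0Pn _ J0; apply: leq_ltn_trans (ltn_ord i).
Qed.

Lemma upow_eq0 x k : (num_components x < k)%N -> upow k << x >> = 0.
Proof.
have [prim xE] := projT2 (cid (decomposition_exists x)).
by move=> lt_k; rewrite [x in << x >>]xE upow_bigsum_eq0.
Qed.

End Bialgebra.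

Theorem theorem3p2 (K : fieldType) :
  exists S : {linear {freeg dclass / K} -> {freeg dclass / K}},
    [/\ is_hopf_algebra (rd_mu K) (rd_eta K) (rd_Delta K) (rd_eps K) S,
        forall k : K,
          S (k *: d_empty K) = rd_e K (k *: d_empty K) /\
          rd_e K (k *: d_empty K) = k *: d_empty K
      & forall (n : nat) (d : {freeg dclass / K}),
          (0 < n)%N -> in_filtration n d -> d <> d_empty K ->
          S d = rd_e K d + \sum_(1 <= k < n.+1) rd_convpow K k d].
Proof.
have alg := rd_algebra K; have coalg := rd_coalgebra K.
have nil := @upow_eq0 K.
pose S := antipode_series (rd_mu K) (rd_eta K) (rd_Delta K) (rd_eps K) num_components.
(* The zeroth term of the series is [rd_e]; the others are the positive convolution powers, and the
   series may be cut at any [n] above the number of components. *)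
have SE n x : (num_components x <= n)%N ->
    S << x >> = rd_e K << x >> + \sum_(1 <= k < n.+1) rd_convpow K k << x >>.
  move=> le_n; rewrite (antipode_seriesU nil le_n) big_ltn //; congr (_ + _).
  apply: eq_big_nat => -[|k] // _; exact/esym/(convpowE alg coalg).
exists S; split.
- by split; [exact: rd_bialgebra | exact: antipode_seriesP].
- move=> k; have eE : rd_e K (d_empty K) = d_empty K.
    rewrite -[LHS]/(rd_eps K << class0 >> *: << class0 >>).
    by rewrite rd_epsU eqxx scale1r.
  rewrite !linearZ eE; split=> //; congr (_ *: _).
  rewrite (SE _ _ (leqnn _)) eE -[RHS]addr0; congr (_ + _).
  apply: big1_seq => -[|j]; rewrite mem_index_iota //= => _.
  (* The empty diagram is the union of the empty list, so every positive power vanishes on it. *)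
  have prim y : y \in [::] -> primitive y by [].
  have := upow_bigsum_eq0 K prim (ltn0Sn j).
  by rewrite big_nil -(convpowE alg coalg).
- move=> n d _ [s [le_s ->]] _; rewrite (linear_sum S) (linear_sum (rd_e K)).
  under [X in _ + X]eq_bigr => k _ do rewrite (linear_sum (rd_convpow K k)).
  (* All basis vectors of [d] have at most [n] components, so [SE] applies to each with the same [n]
     and the formula extends by linearity. *)
  transitivity (\sum_(p <- s) (rd_e K (p.1 *: << p.2 >>) +
      \sum_(1 <= k < n.+1) rd_convpow K k (p.1 *: << p.2 >>))); last first.
    by rewrite big_split; congr (_ + _); apply: exchange_big.
  apply: eq_big_seq => p /le_s le_n.
  have fZ (f : {linear {freeg dclass / K} -> {freeg dclass / K}}) a v : f (a *: v) = a *: f v.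
    exact: linearZ.
  rewrite (fZ S) (fZ (rd_e K)) (SE n _ le_n) scalerDr; congr (_ + _).
  by rewrite scaler_sumr; apply: eq_bigr => k _; rewrite (fZ (rd_convpow K k)).
Qed.
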